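(* Every finite non-cyclic subgroup of $SL(3,\mathbb{Z})$ is conjugate in $GL(3,\mathbb{Z})$ to exactly one of the following sixteen groups (each given by two generators); that is, the list contains exactly one representative of each $\mathbb{Z}$-class of finite non-cyclic subgroups of $SL(3,\mathbb{Z})$: $D_4(1)=\left\langle \begin{pmatrix}-1&0&0\\0&-1&0\\0&0&1\end{pmatrix},\begin{pmatrix}1&0&0\\0&-1&0\\0&0&-1\end{pmatrix}\right\rangle$ $D_4(2)=\left\langle \begin{pmatrix}-1&0&0\\0&-1&0\\0&0&1\end{pmatrix},\begin{pmatrix}0&1&0\\1&0&0\\0&0&-1\end{pmatrix}\right\rangle$ $D_4(3)=\left\langle \begin{pmatrix}-1&0&0\\0&0&-1\\0&-1&0\end{pmatrix},\begin{pmatrix}1&1&1\\0&-1&0\\0&0&-1\end{pmatrix}\right\rangle$ $D_4(4)=\left\langle \begin{pmatrix}-1&-1&-1\\0&0&1\\0&1&0\end{pmatrix},\begin{pmatrix}0&0&1\\-1&-1&-1\\1&0&0\end{pmatrix}\right\rangle$ $D_6(1)=\left\langle \begin{pmatrix}-1&0&0\\1&1&0\\0&0&-1\end{pmatrix},\begin{pmatrix}-1&-1&0\\1&0&0\\0&0&1\end{pmatrix}\right\rangle$ $D_6(2)=\left\langle \begin{pmatrix}0&-1&0\\-1&0&0\\0&0&-1\end{pmatrix},\begin{pmatrix}-1&1&0\\-1&0&0\\0&0&1\end{pmatrix}\right\rangle$ $D_6(3)=\left\langle \begin{pmatrix}-1&0&0\\0&0&-1\\0&-1&0\end{pmatrix},\begin{pmatrix}0&-1&0\\0&0&1\\-1&0&0\end{pmatrix}\right\rangle$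 $D_8(1)=\left\langle \begin{pmatrix}-1&0&0\\0&-1&0\\0&0&1\end{pmatrix},\begin{pmatrix}0&0&-1\\0&1&0\\1&0&0\end{pmatrix}\right\rangle$ $D_8(2)=\left\langle \begin{pmatrix}-1&-1&-1\\0&0&1\\0&1&0\end{pmatrix},\begin{pmatrix}0&-1&0\\0&0&-1\\1&1&1\end{pmatrix}\right\rangle$ $D_{12}=\left\langle \begin{pmatrix}0&1&0\\1&0&0\\0&0&-1\end{pmatrix},\begin{pmatrix}0&1&0\\-1&1&0\\0&0&1\end{pmatrix}\right\rangle$ $A_4(1)=\left\langle \begin{pmatrix}-1&0&0\\0&-1&0\\0&0&1\end{pmatrix},\begin{pmatrix}0&0&1\\1&0&0\\0&1&0\end{pmatrix}\right\rangle$ $A_4(2)=\left\langle \begin{pmatrix}-1&-1&-1\\0&0&1\\0&1&0\end{pmatrix},\begin{pmatrix}0&0&1\\1&0&0\\0&1&0\end{pmatrix}\right\rangle$ $A_4(3)=\left\langle \begin{pmatrix}-1&0&0\\-1&0&1\\-1&1&0\end{pmatrix},\begin{pmatrix}0&0&1\\1&0&0\\0&1&0\end{pmatrix}\right\rangle$ $S_4(1)=\left\langle \begin{pmatrix}0&1&0\\1&0&0\\0&0&-1\end{pmatrix},\begin{pmatrix}0&0&1\\1&0&0\\0&1&0\end{pmatrix}\right\rangle$ $S_4(2)=\left\langle \begin{pmatrix}-1&0&0\\0&-1&0\\1&1&1\end{pmatrix},\begin{pmatrix}0&0&1\\1&0&0\\0&1&0\end{pmatrix}\right\rangle$ $S_4(3)=\left\langle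 \begin{pmatrix}-1&0&0\\0&0&-1\\0&-1&0\end{pmatrix},\begin{pmatrix}-1&0&1\\-1&1&0\\-1&0&0\end{pmatrix}\right\rangle$
   Context: Subgroups $G,H<SL(n,\mathbb{Z})$ are called $\mathbb{Z}$-equivalent if they are conjugate in $GL(n,\mathbb{Z})$; the equivalence classes are called $\mathbb{Z}$-classes. The name of each group indicates its isomorphism type: $D_{2n}$ is the dihedral group of order $2n$ (so $D_4\cong\mathbb{Z}_2\times\mathbb{Z}_2$, $D_6\cong S_3$), and $A_4$, $S_4$ are the alternating and symmetric groups on four elements. *)

(* Defs.v *)
From mathcomp Require Import all_boot all_order all_algebra.
From mathcomp Require Import all_fingroup all_solvable.
From mathcomp Require Import boolp classical_sets functions cardinality.

Set Implicit Arguments.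
Unset Strict Implicit.
Unset Printing Implicit Defensive.

Import GRing.Theory.
Local Open Scope classical_set_scope.
Local Open Scope ring_scope.

(* Since [GL(n, Z)] and [SL(n, Z)] are infinite, their subgroups are          *)
(* represented as classical sets of integer matrices; [unitmx] over [int] is  *)
(* [GL(n, Z)].                                                                *)
Definition SL (n : nat) : set 'M[int]_n := [set A | \det A = 1].

Definition SL_subgroup (n : nat) (G : set 'M[int]_n) : Prop :=
  [/\ G `<=` @SL n,
      G 1%:M,
      forall A B, G A -> G B -> G (A *m B)
    & forall A, G A -> G (invmx A)].

(* Meaningful only when [S] is contained in [SL n].                           *)
Definition SL_generated (n : nat) (S : set 'M[int]_n) : set 'M[int]_n :=
  smallest (@SL_subgroup n) S.

Definition cyclic_SL_subgroup (n : nat) (G : set 'M[int]_n) : Prop :=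
  exists2 A, SL A & G = SL_generated [set A].

Definition Z_equivalent (n : nat) (G H : set 'M[int]_n) : Prop :=
  exists2 P : 'M[int]_n, P \in unitmx &
    H = [set invmx P *m A *m P | A in G].

Definition isomorphic_to (gT : finGroupType) (K : {group gT})
    (n : nat) (G : set 'M[int]_n) : Prop :=
  exists f : gT -> 'M[int]_n,
    [/\ {in K &, forall x y, f (x * y)%g = f x *m f y},
        {in K &, injective f}
      & f @` [set` K] = G].

Definition mx3 (a b c d e f g h i : int) : 'M[int]_3 :=
  \matrix_(r < 3, s < 3)
    (nth [::] [:: [:: a; b; c]; [:: d; e; f]; [:: g; h; i]] r)`_s.

Inductive Zclass : Type :=
| D4_1 | D4_2 | D4_3 | D4_4
| D6_1 | D6_2 | D6_3
| D8_1 | D8_2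
| D12
| A4_1 | A4_2 | A4_3
| S4_1 | S4_2 | S4_3.

Definition Zclass_gens (k : Zclass) : 'M[int]_3 * 'M[int]_3 :=
  match k with
  | D4_1 =>
      (mx3 (-1)    0    0     0 (-1)    0     0    0    1,
       mx3    1    0    0     0 (-1)    0     0    0 (-1))
  | D4_2 =>
      (mx3 (-1)    0    0     0 (-1)    0     0    0    1,
       mx3    0    1    0     1    0    0     0    0 (-1))
  | D4_3 =>
      (mx3 (-1)    0    0     0    0 (-1)     0 (-1)    0,
       mx3    1    1    1     0 (-1)    0     0    0 (-1))
  | D4_4 =>
      (mx3 (-1) (-1) (-1)     0    0    1     0    1    0,
       mx3    0    0    1  (-1) (-1) (-1)     1    0    0)
  | D6_1 =>
      (mx3 (-1)    0    0     1    1    0     0    0 (-1),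
       mx3 (-1) (-1)    0     1    0    0     0    0    1)
  | D6_2 =>
      (mx3    0 (-1)    0  (-1)    0    0     0    0 (-1),
       mx3 (-1)    1    0  (-1)    0    0     0    0    1)
  | D6_3 =>
      (mx3 (-1)    0    0     0    0 (-1)     0 (-1)    0,
       mx3    0 (-1)    0     0    0    1  (-1)    0    0)
  | D8_1 =>
      (mx3 (-1)    0    0     0 (-1)    0     0    0    1,
       mx3    0    0 (-1)     0    1    0     1    0    0)
  | D8_2 =>
      (mx3 (-1) (-1) (-1)     0    0    1     0    1    0,
       mx3    0 (-1)    0     0    0 (-1)     1    1    1)
  | D12 =>
      (mx3    0    1    0     1    0    0     0    0 (-1),
       mx3    0    1    0  (-1)    1    0     0    0    1)
  | A4_1 =>
      (mx3 (-1)    0    0     0 (-1)    0     0    0    1,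
       mx3    0    0    1     1    0    0     0    1    0)
  | A4_2 =>
      (mx3 (-1) (-1) (-1)     0    0    1     0    1    0,
       mx3    0    0    1     1    0    0     0    1    0)
  | A4_3 =>
      (mx3 (-1)    0    0  (-1)    0    1  (-1)    1    0,
       mx3    0    0    1     1    0    0     0    1    0)
  | S4_1 =>
      (mx3    0    1    0     1    0    0     0    0 (-1),
       mx3    0    0    1     1    0    0     0    1    0)
  | S4_2 =>
      (mx3 (-1)    0    0     0 (-1)    0     1    1    1,
       mx3    0    0    1     1    0    0     0    1    0)
  | S4_3 =>
      (mx3 (-1)    0    0     0    0 (-1)     0 (-1)    0,
       mx3 (-1)    0    1  (-1)    1    0  (-1)    0    0)
  end.

Definition Zclass_group (k : Zclass) : set 'M[int]_3 :=
  SL_generated [set (Zclass_gens k).1; (Zclass_gens k).2].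

(* ['D_m] is the dihedral group of order [m]; for [m = 4] it is the Klein     *)
(* four-group.                                                                *)
Definition has_named_type (k : Zclass) (G : set 'M[int]_3) : Prop :=
  match k with
  | D4_1 | D4_2 | D4_3 | D4_4 => isomorphic_to 'D_4%G G
  | D6_1 | D6_2 | D6_3 => isomorphic_to 'D_6%G G
  | D8_1 | D8_2 => isomorphic_to 'D_8%G G
  | D12 => isomorphic_to 'D_12%G G
  | A4_1 | A4_2 | A4_3 => isomorphic_to 'Alt_('I_4)%G G
  | S4_1 | S4_2 | S4_3 => isomorphic_to 'Sym_('I_4)%G G
  end.

(* Main.v *)
Require Import Defs.
From HB Require Import structures.
From mathcomp Require Import all_boot all_order all_algebra.
From mathcomp Require Import all_fingroup all_solvable.
From mathcomp Require Import boolp classical_sets functions cardinality.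
From mathcomp Require Import zify ring.

Set Implicit Arguments.
Unset Strict Implicit.
Unset Printing Implicit Defensive.

Import Order.TTheory GRing.Theory Num.Theory.
Local Open Scope classical_set_scope.
Local Open Scope ring_scope.

(** Existence of a representative rests on the reduction theory of ternary
    quadratic forms. A finite group [G] of integral matrices preserves the
    positive definite form summing the forms [|A x|^2] over the elements [A] of
    [G]. Selling's algorithm ([obtuse_superbase]) finds a basis [e1, e2, e3] of
    the lattice such that the four vectors [e1, e2, e3] and
    [e0 = - e1 - e2 - e3] pairwise have nonpositive inner products. In this
    basis the form is a combination, with six nonnegative coefficients, of the
    squares of the linear forms [x, y, z, x - y, x - z, y - z], which correspond
    to the six pairs of vectors among [e0, e1, e2, e3].

    The forms with positive coefficient are permuted up to sign by [G]
    ([preserves_positive_forms]). Indeed the minimal vectors of the nonzero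
    classes modulo 2 are those on which these forms take values in
    [{-1, 0, 1}]; they include the nonzero vectors of the cube [{0, 1}^3], and
    [G] permutes them. A linear form bounded by 1 on the cube is up to sign one of the six,
    and comparing coefficients shows that the image of a form with positive
    coefficient has a positive coefficient.

    The forms with positive coefficient are the edges of a connected graph on
    four vertices. Each such graph has an explicit finite group of symmetries
    of determinant 1, and an enumeration finds it, up to conjugation, inside
    one of the four groups [D12], [S4_1], [S4_2], [S4_3] ([finite_in_maximal]):
    the rotation groups of the hexagonal lattice and of the three cubic
    lattices. A second enumeration shows that every subgroup of these four is
    generated by two elements and is cyclic or conjugate to one of the sixteen
    groups ([noncyclic_subgroup_of_maximal]).

    For uniqueness ([Z_equivalent_grp]), the numbers of elements of trace -1
    and of trace 0 tell the isomorphism types apart, and the numbers of vectors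
    fixed modulo 2 and modulo 3, in the lattice and in its dual, tell apart the
    lattices on which isomorphic groups act.

    The dihedral types are recognised by a pair of generating involutions. The
    groups of type [A4] and [S4] are identified with permutation groups through
    their action on the four axes of threefold symmetry. *)

(** * Integer matrices as triples of rows *)

Notation row3 := (int * int * int)%type.

(** Call-by-value evaluation computes both arguments of [&&] and [||], whence
    these variants, which stop as soon as the result is known. *)
Notation "a &&& b" := (if a then b else false)
  (at level 65, right associativity) : bool_scope.

Fixpoint search (T : Type) (p : pred T) (s : seq T) : bool :=
  if s is x :: s' then if p x then true else search p s' else false.

Lemma searchE (T : Type) (p : pred T) (s : seq T) : search p s = has p s.
Proof. by elim: s => //= x s ->; case: (p x). Qed.

Lemma searchP (T : eqType) (p : pred T) (s : seq T) :
  reflect (exists2 x, x \in s & p x) (search p s).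
Proof. by rewrite searchE; apply: hasP. Qed.

Lemma uniq_map_inj (T1 T2 : eqType) (f : T1 -> T2) (s : seq T1) :
  uniq (map f s) -> {in s &, injective f}.
Proof.
move=> us x y sx sy eq_f; rewrite -(nth_index x sx) -(nth_index x sy).
congr nth; apply/eqP; rewrite -(nth_uniq (f x) _ _ us) ?size_map ?index_mem //.
by rewrite !(nth_map x) ?index_mem // !nth_index // eq_f.
Qed.

(** A fresh name with its own equality test, so that evaluating [==] does not
    rebuild the equality structure of a product of nine factors each time. *)
Definition mat := (row3 * row3 * row3)%type.

Definition eq_int (m n : int) : bool :=
  match m, n with
  | Posz a, Posz b | Negz a, Negz b => eqn a b
  | _, _ => false
  end.

Definition eq_mat (A B : mat) : bool :=
  let: ((a, b, c), (d, e, f), (g, h, i)) := A in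
  let: ((a', b', c'), (d', e', f'), (g', h', i')) := B in
  eq_int a a' &&& eq_int b b' &&& eq_int c c' &&& eq_int d d' &&&
  eq_int e e' &&& eq_int f f' &&& eq_int g g' &&& eq_int h h' &&&
  eq_int i i'.

Lemma eq_intP : Equality.axiom eq_int.
Proof.
case=> m [] n; apply: (iffP idP) => //=.
- by move/eqnP->.
- by case=> ->; apply/eqnP.
- by move/eqnP->.
- by case=> ->; apply/eqnP.
Qed.

Lemma eq_matP : Equality.axiom eq_mat.
Proof.
case=> [[[[a b] c] [[d e] f]] [[g h] i]].
case=> [[[[a' b'] c'] [[d' e'] f']] [[g' h'] i']].
apply: (iffP idP) => [|[<- <- <- <- <- <- <- <- <-]] /=.
  by do 8![case: eq_intP => // ->]; move/eq_intP->.
by do 9![case: eq_intP => //].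
Qed.

HB.instance Definition _ := hasDecEq.Build mat eq_matP.

Definition mx_of (A : mat) : 'M[int]_3 :=
  let: ((a, b, c), (d, e, f), (g, h, i)) := A in mx3 a b c d e f g h i.

Definition dot (u v : row3) : int :=
  let: (a, b, c) := u in let: (x, y, z) := v in a * x + b * y + c * z.

Definition tr3 (A : mat) : mat :=
  let: ((a, b, c), (d, e, f), (g, h, i)) := A in
  ((a, d, g), (b, e, h), (c, f, i)).

Definition row_mul3 (u : row3) (B : mat) : row3 :=
  let: (c1, c2, c3) := tr3 B in (dot u c1, dot u c2, dot u c3).

Definition mul3 (A B : mat) : mat :=
  let: (r1, r2, r3) := A in (row_mul3 r1 B, row_mul3 r2 B, row_mul3 r3 B).

Definition one3 : mat := ((1, 0, 0), (0, 1, 0), (0, 0, 1)).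

Definition det3 (A : mat) : int :=
  let: ((a, b, c), (d, e, f), (g, h, i)) := A in
  a * (e * i - f * h) - b * (d * i - f * g) + c * (d * h - e * g).

Definition scale3 (k : int) (A : mat) : mat :=
  let: ((a, b, c), (d, e, f), (g, h, i)) := A in
  ((k * a, k * b, k * c), (k * d, k * e, k * f), (k * g, k * h, k * i)).

Definition adj3 (A : mat) : mat :=
  let: ((a, b, c), (d, e, f), (g, h, i)) := A in
  ((e * i - f * h, c * h - b * i, b * f - c * e),
   (f * g - d * i, a * i - c * g, c * d - a * f),
   (d * h - e * g, b * g - a * h, a * e - b * d)).

(** The inverse when the determinant, being 1 or -1, is its own inverse. *)
Definition inv3 (A : mat) : mat := scale3 (det3 A) (adj3 A).

Definition trace3 (A : mat) : int :=
  let: ((a, b, c), (d, e, f), (g, h, i)) := A in a + e + i.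

Definition unit3 (A : mat) := (det3 A == 1) || (det3 A == -1).

Ltac mx3_entries :=
  apply/matrixP => -[[|[|[|?]]] ?] [[|[|[|?]]] ?] //;
  rewrite !mxE ?big_ord_recl ?big_ord0 ?mxE /= ?mxE /=.

Lemma mx_of_mul A B : mx_of (mul3 A B) = mx_of A *m mx_of B.
Proof.
case: A => [[[[a b] c] [[d e] f]] [[g h] i]].
case: B => [[[[a' b'] c'] [[d' e'] f']] [[g' h'] i']].
by mx3_entries; ring.
Qed.

Lemma mx_of_id : mx_of one3 = 1%:M.
Proof. by mx3_entries. Qed.

Lemma mx_of_tr A : mx_of (tr3 A) = (mx_of A)^T.
Proof. by case: A => [[[[a b] c] [[d e] f]] [[g h] i]]; mx3_entries. Qed.

Lemma mx_of_inj : injective mx_of.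
Proof.
case=> [[[[a b] c] [[d e] f]] [[g h] i]].
case=> [[[[a' b'] c'] [[d' e'] f']] [[g' h'] i']] /matrixP eqAB.
have eqn (r s : nat) (lt_r : (r < 3)%N) (lt_s : (s < 3)%N) :=
  eqAB (Ordinal lt_r) (Ordinal lt_s).
move: (eqn 0 0 isT isT)%N (eqn 0 1 isT isT)%N (eqn 0 2 isT isT)%N.
move: (eqn 1 0 isT isT)%N (eqn 1 1 isT isT)%N (eqn 1 2 isT isT)%N.
move: (eqn 2 0 isT isT)%N (eqn 2 1 isT isT)%N (eqn 2 2 isT isT)%N.
by rewrite !mxE /= => -> -> -> -> -> -> -> -> ->.
Qed.

Definition of_mx (A : 'M[int]_3) : mat :=
  let a i j := A (inord i) (inord j) in
  ((a 0%N 0%N, a 0%N 1%N, a 0%N 2%N), (a 1%N 0%N, a 1%N 1%N, a 1%N 2%N),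
   (a 2%N 0%N, a 2%N 1%N, a 2%N 2%N)).

Lemma of_mxK : cancel of_mx mx_of.
Proof.
move=> A; apply/matrixP => i j.
rewrite -[in RHS](inord_val i) -[in RHS](inord_val j).
by case: i j => [[|[|[|?]]] ?] [[|[|[|?]]] ?] //; rewrite !mxE.
Qed.

Lemma mx_ofK : cancel mx_of of_mx.
Proof. by move=> A; apply: mx_of_inj; rewrite of_mxK. Qed.

Lemma det_mx_of A : \det (mx_of A) = det3 A.
Proof.
case: A => [[[[a b] c] [[d e] f]] [[g h] i]].
do !rewrite ?(expand_det_row _ ord0) ?big_ord_recl ?big_ord0 /cofactor
            ?det_mx11.
by rewrite !mxE /= /bump /=; ring.
Qed.

Lemma unitmx_mx_of A : (mx_of A \in unitmx) = unit3 A.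
Proof. by rewrite unitmxE det_mx_of. Qed.

Lemma mul3A : associative mul3.
Proof. by move=> A B C; apply: mx_of_inj; rewrite !mx_of_mul mulmxA. Qed.
Lemma mul13 : left_id one3 mul3.
Proof. by move=> A; apply: mx_of_inj; rewrite mx_of_mul mx_of_id mul1mx. Qed.
Lemma mul31 : right_id one3 mul3.
Proof. by move=> A; apply: mx_of_inj; rewrite mx_of_mul mx_of_id mulmx1. Qed.

Lemma mul3V A : unit3 A -> mul3 A (inv3 A) = one3.
Proof.
rewrite /unit3 /inv3.
case: A => [[[[a b] c] [[d e] f]] [[g h] i]].
set k := det3 _ => k2; have {k2} k2 : k * k = 1 by case/orP: k2 => /eqP ->.
by congr (_, _, _); congr (_, _, _); rewrite -?[RHS]k2 /k /=; ring.
Qed.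

Lemma mx_of_inv A : unit3 A -> mx_of (inv3 A) = invmx (mx_of A).
Proof.
move=> uA; have uA' : mx_of A \in unitmx by rewrite unitmx_mx_of.
by rewrite -[LHS](mulKmx uA') -mx_of_mul mul3V // mx_of_id mulmx1.
Qed.

Lemma mulV3 A : unit3 A -> mul3 (inv3 A) A = one3.
Proof.
move=> uA; apply: mx_of_inj; rewrite mx_of_mul mx_of_inv // mulVmx ?mx_of_id //.
by rewrite unitmx_mx_of.
Qed.

(** * Subgroups up to conjugacy *)

Section Conjugation.

Variable n : nat.
Implicit Types (A B P : 'M[int]_n) (G H K : set 'M[int]_n).

Definition conjmx P A := invmx P *m A *m P.

Lemma conjmxM P A B : P \in unitmx ->
  conjmx P (A *m B) = conjmx P A *m conjmx P B.
Proof. by move=> uP; rewrite /conjmx !mulmxA mulmxK. Qed.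

Lemma conjmx1 P : P \in unitmx -> conjmx P 1%:M = 1%:M.
Proof. by move=> uP; rewrite /conjmx mulmx1 mulVmx. Qed.

Lemma conjmxK P A : P \in unitmx -> conjmx P (conjmx (invmx P) A) = A.
Proof.
by move=> uP; rewrite /conjmx invmxK !mulmxA mulVmx // mul1mx mulmxKV.
Qed.

Lemma conjmxVK P A : P \in unitmx -> conjmx (invmx P) (conjmx P A) = A.
Proof.
by move=> uP; rewrite /conjmx invmxK !mulmxA mulmxV // mul1mx mulmxK.
Qed.

Lemma det_conjmx P A : P \in unitmx -> \det (conjmx P A) = \det A.
Proof.
by move=> uP; rewrite /conjmx !det_mulmx mulrAC -det_mulmx mulVmx // det1 mul1r.
Qed.

Lemma SL_unitmx A : SL A -> A \in unitmx.
Proof. by rewrite unitmxE => ->; rewrite unitr1. Qed.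

Lemma conjmxV P A : P \in unitmx -> A \in unitmx ->
  conjmx P (invmx A) = invmx (conjmx P A).
Proof.
move=> uP uA; have uPA : conjmx P A \in unitmx.
  by rewrite unitmxE det_conjmx // -unitmxE.
by rewrite -[LHS](mulKmx uPA) -conjmxM // mulmxV // conjmx1 // mulmx1.
Qed.

Lemma conjmx_mul P Q A : P \in unitmx -> Q \in unitmx ->
  conjmx (P *m Q) A = conjmx Q (conjmx P A).
Proof.
move=> uP uQ; have uPQ : P *m Q \in unitmx by rewrite unitmx_mul uP.
have invPQ : invmx (P *m Q) = invmx Q *m invmx P.
  by rewrite -[RHS](mulKmx uPQ) -!mulmxA (mulmxA Q) mulmxV // mul1mx mulmxV
             // mulmx1.
by rewrite /conjmx invPQ !mulmxA.
Qed.

Lemma preim_conjmx_subgroup P K : P \in unitmx -> SL_subgroup K ->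
  SL_subgroup [set A | K (conjmx P A)].
Proof.
move=> uP [sK K1 KM KV]; have sPK A : K (conjmx P A) -> SL A.
  by move=> /sK; rewrite /SL /= det_conjmx.
split=> //=; first by rewrite conjmx1.
  by move=> A B /= KA KB; rewrite conjmxM //; apply: KM.
by move=> A /= KA; rewrite conjmxV //; [apply: KV | apply/SL_unitmx/sPK].
Qed.

(** A preimage description, which turns membership in the conjugate group into
    membership in the original one. *)
Lemma Z_equivalentP G H :
  Z_equivalent G H <->
  exists2 P, P \in unitmx & H = [set A | G (conjmx (invmx P) A)].
Proof.
have imageE P : P \in unitmx ->
    [set invmx P *m A *m P | A in G] = [set A | G (conjmx (invmx P) A)].
  move=> uP; apply/seteqP; split=> A /=.
    by case=> B GB <-; rewrite -/(conjmx P B) conjmxVK.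
  move=> GA; exists (conjmx (invmx P) A) => //.
  by rewrite -/(conjmx P _) conjmxK.
by split=> -[P uP ->]; exists P; rewrite ?imageE.
Qed.

Lemma Z_equivalent_sym G H : Z_equivalent G H -> Z_equivalent H G.
Proof.
move=> /Z_equivalentP[P uP ->]; apply/Z_equivalentP.
exists (invmx P); first by rewrite unitmx_inv.
by apply/seteqP; split=> A /=; rewrite invmxK conjmxVK.
Qed.

Lemma Z_equivalent_trans G H K :
  Z_equivalent G H -> Z_equivalent H K -> Z_equivalent G K.
Proof.
move=> [P uP ->] [Q uQ ->]; exists (P *m Q); first by rewrite unitmx_mul uP.
rewrite image_comp; apply: eq_imagel => A _ /=.
by rewrite -!/(conjmx _ _) conjmx_mul.
Qed.

Lemma Z_equivalent_subgroup G H :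
  Z_equivalent G H -> SL_subgroup G -> SL_subgroup H.
Proof.
move=> /Z_equivalentP[P uP ->]; apply: preim_conjmx_subgroup.
by rewrite unitmx_inv.
Qed.

Lemma SL_subgroup_SL : SL_subgroup (@SL n).
Proof.
split=> //=; first by rewrite /SL /= det1.
  by move=> A B /= A1 B1; rewrite /SL /= det_mulmx A1 B1 mulr1.
by move=> A /= A1; rewrite /SL /= det_inv A1 invr1.
Qed.

Lemma SL_generated_subgroup (S : set 'M[int]_n) :
  S `<=` @SL n -> SL_subgroup (SL_generated S).
Proof.
move=> sS; have SLS := conj SL_subgroup_SL sS; split=> [A gA||A B gA gB|A gA].
- exact: (gA _ SLS).
- by move=> K /= [[]].
- move=> K /= KS; have [[_ _ KM _] _] := KS.
  by apply: KM; [apply: gA | apply: gB].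
- by move=> K /= KS; have [[_ _ _ KV] _] := KS; apply: KV; apply: gA.
Qed.

(** Being stated through the subgroups that contain a generator, this criterion
    is visibly invariant under conjugation. *)
Lemma cyclic_SL_subgroupP G : SL_subgroup G ->
  cyclic_SL_subgroup G <->
  exists2 A, G A & forall K, SL_subgroup K -> K A -> G `<=` K.
Proof.
move=> sG; have [GSL _ _ _] := sG; split=> [[A A1 ->]|[A GA minG]].
  exists A; first by move=> K /= [_]; apply.
  by move=> K sK KA; apply: smallest_sub => // _ ->.
exists A; first exact: GSL.
apply/seteqP; split; last by apply: smallest_sub => // _ ->.
apply: minG; first by apply: SL_generated_subgroup => _ ->; apply: GSL.
by move=> K /= [_]; apply.
Qed.

Lemma Z_equivalent_cyclic G H : SL_subgroup G ->
  Z_equivalent G H -> cyclic_SL_subgroup H -> cyclic_SL_subgroup G.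
Proof.
move=> sG eqGH; have sH := Z_equivalent_subgroup eqGH sG.
move=> /(cyclic_SL_subgroupP sH)[A HA minH]; apply/(cyclic_SL_subgroupP sG).
have [P uP defH] := (Z_equivalentP G H).1 eqGH.
have uP' : invmx P \in unitmx by rewrite unitmx_inv.
exists (conjmx (invmx P) A); first by move: HA; rewrite defH.
move=> K sK KA B GB; rewrite -(conjmxVK B uP).
apply: (minH _ (preim_conjmx_subgroup uP' sK)) => //=.
by rewrite defH /= conjmxVK.
Qed.

End Conjugation.

(** * Finite groups of matrices given by lists *)

Definition set_of (l : seq mat) : set 'M[int]_3 := [set A | of_mx A \in l].

Lemma set_of_mx l A : set_of l (mx_of A) = (A \in l).
Proof. by rewrite /set_of /= mx_ofK. Qed.

Lemma finite_set_of l : finite_set (set_of l).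
Proof.
rewrite (_ : set_of l = mx_of @` [set` l]); first exact: finite_image.
apply/seteqP; split=> [A lA|_ [A lA <-]]; last by rewrite set_of_mx.
by exists (of_mx A); rewrite ?of_mxK.
Qed.

Fixpoint saturate (rounds : nat) (gens known frontier : seq mat) : seq mat :=
  if rounds is rounds'.+1 then
    let products := [seq mul3 A B | A <- frontier, B <- gens] in
    let fresh := undup [seq C <- products | C \notin known] in
    if nilp fresh then known
    else saturate rounds' gens (known ++ fresh) fresh
  else known.

(** Whatever the bound on the number of rounds, the list contains the
    generators and lies in every group that contains them. Once the test
    [is_group] has shown that it is closed under products, it is the group
    generated. *)
Definition closure (gens : seq mat) : seq mat :=
  let seeds := undup (one3 :: gens) in saturate 24 gens seeds seeds.

Definition is_group (l : seq mat) : bool :=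
  [&& uniq l, one3 \in l, all (fun A => det3 A == 1) l,
      all (fun A => all (fun B => mul3 A B \in l) l) l
    & all (fun A => inv3 A \in l) l].

Lemma is_group_subgroup l : is_group l -> SL_subgroup (set_of l).
Proof.
case/and5P=> _ l1 /allP lSL /allP lM /allP lV.
have SLl A : set_of l A -> \det A = 1.
  by move=> /lSL /eqP <-; rewrite -det_mx_of of_mxK.
split=> //; first by rewrite -mx_of_id set_of_mx.
  move=> A B lA lB; rewrite -(of_mxK A) -(of_mxK B) -mx_of_mul set_of_mx.
  exact: (allP (lM _ lA)).
move=> A lA; rewrite -(of_mxK A) -mx_of_inv ?set_of_mx; first exact: lV.
by rewrite /unit3 (lSL _ lA).
Qed.

Lemma sub_closure gens : {subset gens <= closure gens}.
Proof.
move=> A gA.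
have grow n known fr : A \in known -> A \in saturate n gens known fr.
  elim: n known fr => [//|n IHn] known fr lA /=.
  by case: ifP => // _; apply: IHn; rewrite mem_cat lA.
by apply: grow; rewrite mem_undup inE gA orbT.
Qed.

Lemma closure_min gens G : SL_subgroup G -> {in gens, forall A, G (mx_of A)} ->
  set_of (closure gens) `<=` G.
Proof.
move=> [_ G1 GM _] Ggens.
pose inG (l : seq mat) := {in l, forall A, G (mx_of A)}.
have Gsat n known fr : inG known -> inG fr -> inG (saturate n gens known fr).
  elim: n known fr => [//|n IHn] known fr Gknown Gfr /=.
  set fresh := undup _; case: ifP => // _.
  have Gfresh: inG fresh.
    move=> A; rewrite mem_undup mem_filter => /andP[_].
    case/allpairsP=> -[B C] /= [/Gfr GB /Ggens GC ->].
    by rewrite mx_of_mul; apply: GM.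
  by apply: IHn => // A; rewrite mem_cat => /orP[/Gknown|/Gfresh].
have Gseeds: inG (undup (one3 :: gens)).
  by move=> A; rewrite mem_undup inE => /predU1P[->|/Ggens//]; rewrite mx_of_id.
move=> A; rewrite -[A in G A]of_mxK /set_of /= /closure.
exact: (Gsat 24%N).
Qed.

Lemma SL_generated_closure A B : is_group (closure [:: A; B]) ->
  SL_generated [set mx_of A; mx_of B] = set_of (closure [:: A; B]).
Proof.
move=> /is_group_subgroup sAB; apply/seteqP; split.
  apply: smallest_sub => // _ [] ->; rewrite set_of_mx sub_closure //.
    by rewrite mem_head.
  by rewrite !inE eqxx orbT.
move=> C; apply: closure_min => [|D].
  have [ABSL _ _ _] := sAB.
  apply: SL_generated_subgroup => _ [] ->; apply: ABSL;
    by rewrite set_of_mx sub_closure // !inE eqxx ?orbT.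
by rewrite !inE => /orP[]/eqP-> K [_]; apply; [left | right].
Qed.

(* Conversion would otherwise try to evaluate closures of lists of variables. *)
Strategy 1000 [closure saturate].

Definition is_cyclic (l : seq mat) : bool :=
  has (fun A => all (mem (closure [:: A])) l) l.

Lemma is_cyclic_cyclic l : SL_subgroup (set_of l) -> is_cyclic l ->
  cyclic_SL_subgroup (set_of l).
Proof.
move=> sl /hasP[A lA /allP cA]; apply/(cyclic_SL_subgroupP sl).
exists (mx_of A); first by rewrite set_of_mx.
by move=> K sK KA B /cA; apply: (closure_min sK) => C; rewrite inE => /eqP->.
Qed.

(** The converse needs the closures of single elements to be groups: a
    generator of the group then has all of it in its closure. *)
Lemma cyclic_is_cyclic l : is_group l ->
  all (fun A => is_group (closure [:: A])) l ->
  cyclic_SL_subgroup (set_of l) -> is_cyclic l.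
Proof.
move=> /is_group_subgroup sl /allP gcl /(cyclic_SL_subgroupP sl)[A lA minl].
apply/hasP; exists (of_mx A) => //; apply/allP=> B.
rewrite -set_of_mx => lB; rewrite inE -set_of_mx; apply: minl lB.
  exact/is_group_subgroup/gcl.
by apply: sub_closure; rewrite mem_head.
Qed.

Lemma set_of_eq l1 l2 : l1 =i l2 -> set_of l1 = set_of l2.
Proof. by move=> eql; apply/seteqP; split=> A; rewrite /set_of /= eql. Qed.

Definition same (l1 l2 : seq mat) : bool :=
  (size l1 == size l2) &&& all (mem l2) l1 &&& all (mem l1) l2.

Lemma sameP l1 l2 : same l1 l2 -> l1 =i l2.
Proof.
rewrite /same; case: eqP => // _; case: allP => // s12 /allP s21 A.
by apply/idP/idP => [/s12|/s21].
Qed.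
Definition conj3 (P A : mat) : mat := mul3 (mul3 (inv3 P) A) P.

Lemma mx_of_conj P A : unit3 P ->
  mx_of (conj3 P A) = conjmx (mx_of P) (mx_of A).
Proof. by move=> uP; rewrite !mx_of_mul mx_of_inv. Qed.

Lemma set_of_conj P l : unit3 P ->
  Z_equivalent (set_of l) (set_of [seq conj3 P A | A <- l]).
Proof.
move=> uP; exists (mx_of P); first by rewrite unitmx_mx_of.
apply/seteqP; split=> [A|_ [A lA <-]].
  case/mapP=> B lB defA; exists (mx_of B); first by rewrite set_of_mx.
  by rewrite -[RHS]of_mxK defA mx_of_conj.
rewrite -(of_mxK A) -/(conjmx _ _) -mx_of_conj // set_of_mx.
exact: map_f.
Qed.

(** * The sixteen groups *)

Definition all_classes : seq Zclass :=
  [:: D4_1; D4_2; D4_3; D4_4; D6_1; D6_2; D6_3; D8_1; D8_2; D12;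
      A4_1; A4_2; A4_3; S4_1; S4_2; S4_3].

Definition class_index (k : Zclass) : nat :=
  match k with
  | D4_1 => 0 | D4_2 => 1 | D4_3 => 2 | D4_4 => 3 | D6_1 => 4 | D6_2 => 5
  | D6_3 => 6 | D8_1 => 7 | D8_2 => 8 | D12 => 9 | A4_1 => 10 | A4_2 => 11
  | A4_3 => 12 | S4_1 => 13 | S4_2 => 14 | S4_3 => 15
  end%N.

Lemma class_indexK : cancel class_index (nth D4_1 all_classes).
Proof. by case. Qed.

HB.instance Definition _ := Equality.copy Zclass (can_type class_indexK).

Definition gens (k : Zclass) : mat * mat :=
  match k with
  | D4_1 =>
      (((-1, 0, 0), (0, -1, 0), (0, 0, 1)),
       ((1, 0, 0), (0, -1, 0), (0, 0, -1)))
  | D4_2 =>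
      (((-1, 0, 0), (0, -1, 0), (0, 0, 1)),
       ((0, 1, 0), (1, 0, 0), (0, 0, -1)))
  | D4_3 =>
      (((-1, 0, 0), (0, 0, -1), (0, -1, 0)),
       ((1, 1, 1), (0, -1, 0), (0, 0, -1)))
  | D4_4 =>
      (((-1, -1, -1), (0, 0, 1), (0, 1, 0)),
       ((0, 0, 1), (-1, -1, -1), (1, 0, 0)))
  | D6_1 =>
      (((-1, 0, 0), (1, 1, 0), (0, 0, -1)),
       ((-1, -1, 0), (1, 0, 0), (0, 0, 1)))
  | D6_2 =>
      (((0, -1, 0), (-1, 0, 0), (0, 0, -1)),
       ((-1, 1, 0), (-1, 0, 0), (0, 0, 1)))
  | D6_3 =>
      (((-1, 0, 0), (0, 0, -1), (0, -1, 0)),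
       ((0, -1, 0), (0, 0, 1), (-1, 0, 0)))
  | D8_1 =>
      (((-1, 0, 0), (0, -1, 0), (0, 0, 1)),
       ((0, 0, -1), (0, 1, 0), (1, 0, 0)))
  | D8_2 =>
      (((-1, -1, -1), (0, 0, 1), (0, 1, 0)),
       ((0, -1, 0), (0, 0, -1), (1, 1, 1)))
  | D12 =>
      (((0, 1, 0), (1, 0, 0), (0, 0, -1)),
       ((0, 1, 0), (-1, 1, 0), (0, 0, 1)))
  | A4_1 =>
      (((-1, 0, 0), (0, -1, 0), (0, 0, 1)),
       ((0, 0, 1), (1, 0, 0), (0, 1, 0)))
  | A4_2 =>
      (((-1, -1, -1), (0, 0, 1), (0, 1, 0)),
       ((0, 0, 1), (1, 0, 0), (0, 1, 0)))
  | A4_3 =>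
      (((-1, 0, 0), (-1, 0, 1), (-1, 1, 0)),
       ((0, 0, 1), (1, 0, 0), (0, 1, 0)))
  | S4_1 =>
      (((0, 1, 0), (1, 0, 0), (0, 0, -1)),
       ((0, 0, 1), (1, 0, 0), (0, 1, 0)))
  | S4_2 =>
      (((-1, 0, 0), (0, -1, 0), (1, 1, 1)),
       ((0, 0, 1), (1, 0, 0), (0, 1, 0)))
  | S4_3 =>
      (((-1, 0, 0), (0, 0, -1), (0, -1, 0)),
       ((-1, 0, 1), (-1, 1, 0), (-1, 0, 0)))
  end.

Definition grp (k : Zclass) : seq mat := closure [:: (gens k).1; (gens k).2].

Lemma Zclass_gensE k : Zclass_gens k = (mx_of (gens k).1, mx_of (gens k).2).
Proof. by case: k. Qed.

Lemma is_group_grp k : is_group (grp k).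
Proof. by case: k; vm_compute. Qed.

Lemma Zclass_groupE k : Zclass_group k = set_of (grp k).
Proof.
rewrite /Zclass_group Zclass_gensE /= SL_generated_closure //.
exact: is_group_grp.
Qed.

Lemma grp_not_cyclic k : ~ cyclic_SL_subgroup (set_of (grp k)).
Proof.
have noncyc: ~~ is_cyclic (grp k) by case: k; vm_compute.
move=> cyc; case/negP: noncyc; apply: cyclic_is_cyclic cyc.
  exact: is_group_grp.
by case: k; vm_compute.
Qed.

(** * Subgroups of the four maximal groups *)

(** The rotation groups of the hexagonal and of the three cubic lattices. *)
Definition maximal : seq Zclass := [:: D12; S4_1; S4_2; S4_3].

Definition span (l gens : seq mat) : seq mat :=
  let s := closure gens in [seq A <- l | A \in s].

(** The elements of each subgroup come in the order of [l], so that equality of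
    subgroups is equality of lists. *)
Definition subgroups2 (l : seq mat) : seq (seq mat * seq mat) :=
  foldr (fun gens subs =>
      let s := span l gens in
      if search (fun t => s == t.2) subs then subs else (gens, s) :: subs)
    [:: ([:: one3], [:: one3])] [seq [:: A; B] | A <- l, B <- l].

(** A third generator either lies in the subgroup or yields a strictly larger
    entry of the list; the increase in size makes the ascent from the trivial
    subgroup to a given one terminate. *)
Definition three_generators_reduce l (subs : seq (seq mat * seq mat)) : bool :=
  all (fun s => all (fun C =>
    if C \in s.2 then true else
    let s' := span l (C :: s.1) in
    (size s.2 < size s')%N &&& search (fun t => s' == t.2) subs) l) subs.

(** All the conjugations needed are by products of an element of a maximal
    group and one of these matrices: the former permutes the subgroups or the
    graphs of the same shape, the latter changes the basis of the lattice. *)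
Definition base_changes : seq mat :=
  [:: one3;
      ((0, 1, 0), (-1, 0, 0), (0, 0, 1));
      ((0, 0, -1), (0, 1, 0), (1, 1, 0));
      ((1, 0, 1), (0, -1, 0), (1, 0, 0))].

Definition conjugate_to_one_of (targets : seq (seq mat)) (l s : seq mat) :=
  search (fun A => search (fun B =>
    let P := mul3 A B in
    unit3 P &&&
    (let s' := [seq conj3 P C | C <- s] in search (same s') targets))
    base_changes) l.

Definition subgroups_classified (targets : seq (seq mat)) (l : seq mat) :=
  let subs := subgroups2 l in
  [&& ([:: one3], [:: one3]) \in subs,
      all (fun s => all (mem s.2) s.1) subs,
      three_generators_reduce l subs
    & all (fun s => if is_cyclic s.2 then true
                    else conjugate_to_one_of targets l s.2) subs].

Definition maximal_subgroups_classified : bool :=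
  let targets := [seq grp k | k <- all_classes] in
  all (fun k => subgroups_classified targets (grp k)) maximal.

Lemma maximal_subgroups_classifiedT : maximal_subgroups_classified.
Proof. by vm_cast_no_check (erefl true). Qed.

(** Starting from the trivial subgroup, elements of [H] are adjoined one at a
    time. Each step stays inside the list of two-generated subgroups, and the
    sizes increase up to that of [l] at most. *)
Lemma subgroup_of_list l (subs : seq (seq mat * seq mat)) H :
  ([:: one3], [:: one3]) \in subs -> all (fun s => all (mem s.2) s.1) subs ->
  three_generators_reduce l subs ->
  SL_subgroup H -> H `<=` set_of l ->
  exists2 s, s \in subs & H = set_of s.2.
Proof.
move=> subs1 /allP subs_gens /allP red sH sHl.
have [_ H1 _ _] := sH.
have step s : s \in subs -> set_of s.2 `<=` H -> H = set_of s.2 \/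
    exists t, [/\ t \in subs, set_of t.2 `<=` H
                & size s.2 < size t.2 <= size l]%N.
  move=> sub_s sH_s.
  have [Hs|/existsNP[A /not_implyP[HA nsA]]] :=
      pselect (forall A, H A -> set_of s.2 A).
    by left; apply/seteqP.
  have lA : of_mx A \in l by apply: sHl.
  have /= := allP (red s sub_s) _ lA; case: ifP => [sA|_]; first by case: nsA.
  case: ifP => // lt_s /searchP[t sub_t /eqP def_t].
  right; exists t; split=> //.
    rewrite -def_t => B; rewrite /set_of /= mem_filter => /andP[clB _].
    apply: (closure_min sH _ clB) => C; rewrite inE => /predU1P[->|sC].
      by rewrite of_mxK.
    by apply: sH_s; rewrite set_of_mx; apply: (allP (subs_gens _ sub_s)).
  by rewrite -def_t lt_s size_filter count_size.
suffices grow n s : s \in subs -> set_of s.2 `<=` H ->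
    (size l < size s.2 + n)%N -> exists2 s', s' \in subs & H = set_of s'.2.
  apply: (grow (size l) _ subs1) => // A.
  by rewrite /set_of /= inE => /eqP defA; rewrite -(of_mxK A) defA mx_of_id.
elim: n s => [|n IHn] s sub_s sH_s lt_n;
  have [defH|[t [sub_t sH_t /andP[lt_st le_tl]]]] := step s sub_s sH_s;
  try by exists s.
  by rewrite addn0 ltnNge (leq_trans (ltnW lt_st)) in lt_n.
apply: (IHn t) => //; apply: leq_trans lt_n _.
by rewrite -addSnnS leq_add2r.
Qed.

Lemma conjugate_to_one_ofP targets l s :
  conjugate_to_one_of targets l s ->
  exists2 t, t \in targets & Z_equivalent (set_of s) (set_of t).
Proof.
case/searchP=> A _ /searchP[B _] /=; case: ifP => // uP.
case/searchP=> t Tt /sameP eq_t.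
by exists t => //; rewrite -(set_of_eq eq_t); apply: set_of_conj.
Qed.

Lemma noncyclic_subgroup_of_maximal k H : k \in maximal ->
  SL_subgroup H -> H `<=` set_of (grp k) -> ~ cyclic_SL_subgroup H ->
  exists k', Z_equivalent H (set_of (grp k')).
Proof.
move=> max_k sH sHk; have /and4P[subs1 subs_gens red /allP cls] :=
  allP maximal_subgroups_classifiedT _ max_k.
have [s sub_s defH] := subgroup_of_list subs1 subs_gens red sH sHk.
have: if is_cyclic s.2 then true
      else conjugate_to_one_of [seq grp k | k <- all_classes] (grp k) s.2 :=
  cls s sub_s.
case: ifP => [cyc _ []|_ /conjugate_to_one_ofP[t]].
  by rewrite defH; apply: is_cyclic_cyclic => //; rewrite -defH.
by case/mapP=> k' _ ->; rewrite -defH; exists k'.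
Qed.

(** * Symmetries of graphic configurations of linear forms *)

(** With [x0 = 0], these are the differences [x_i - x_j] of coordinates: the
    edges of the complete graph on four vertices, up to sign. *)
Definition forms : seq row3 :=
  [:: (1, 0, 0); (0, 1, 0); (0, 0, 1); (1, -1, 0); (1, 0, -1); (0, 1, -1)].

Definition opp3 (u : row3) : row3 := let: (a, b, c) := u in (- a, - b, - c).

Definition signed (E : seq row3) : seq row3 := E ++ [seq opp3 f | f <- E].

Definition cube : seq row3 :=
  [:: (0, 0, 0); (1, 0, 0); (0, 1, 0); (0, 0, 1);
      (1, 1, 0); (1, 0, 1); (0, 1, 1); (1, 1, 1)].

(** The set of edges [E] is disconnected: the forms in [E] vanish on the
    indicator vector of a component that does not contain the vertex 0. *)
Definition degenerate (E : seq row3) : bool :=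
  has (fun v => (v != (0, 0, 0)) && all (fun f => dot f v == 0) E) cube.

Definition preserves (E : seq row3) (g : mat) : bool :=
  (det3 g == 1) &&& all (fun f => row_mul3 f g \in signed E) E.

Definition triples (E : seq row3) : seq mat :=
  [seq (uv, w) : mat | uv <- [seq (u, v) | u <- E, v <- E], w <- E].

(** When the rows of [F] are a basis of the dual lattice drawn from [E], a
    matrix preserving [E] is determined by the images of these rows. *)
Definition stabilizer (E : seq row3) (F : mat) : seq mat :=
  [seq g <- [seq mul3 (inv3 F) R | R <- triples (signed E)] | preserves E g].

Definition conjugate_into_one_of (targets : seq (seq mat)) (l s : seq mat) :=
  search (fun A => search (fun B =>
    let P := mul3 A B in
    unit3 P &&&
    search (fun t => all (fun g => conj3 P g \in t) s) targets) base_changes) l.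

Definition stabilizer_in_one_of (targets : seq (seq mat)) (l : seq mat)
    (E : seq row3) : bool :=
  if degenerate E then true else
  search (fun F => unit3 F &&& conjugate_into_one_of targets l (stabilizer E F))
    (triples E).

Fixpoint sublists (T : Type) (s : seq T) : seq (seq T) :=
  if s is x :: s' then
    let r := sublists s' in r ++ [seq x :: t | t <- r]
  else [:: [::]].

Lemma filter_sublists (T : eqType) (p : pred T) (s : seq T) :
  filter p s \in sublists s.
Proof.
elim: s => //= x s IHs; rewrite mem_cat; case: (p x); last by rewrite IHs.
by rewrite map_f ?orbT.
Qed.

(** The group [S4_3] permutes the six forms up to sign as the symmetric group
    permutes the edges of the complete graph, so it moves any graph to any
    other of the same shape. *)
Definition stabilizers_in_maximal : bool :=
  let targets := [seq grp k | k <- maximal] in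
  let l := grp S4_3 in
  all (stabilizer_in_one_of targets l) (sublists forms).

Lemma stabilizers_in_maximalT : stabilizers_in_maximal.
Proof. by vm_cast_no_check (erefl true). Qed.

Lemma mem_triples (E : seq row3) u v w :
  u \in E -> v \in E -> w \in E -> ((u, v), w) \in triples E.
Proof.
move=> Eu Ev Ew; apply/allpairsP; exists ((u, v), w); split=> //.
by apply: allpairs_f.
Qed.

Lemma triplesP (E : seq row3) (F : mat) :
  F \in triples E -> [/\ F.1.1 \in E, F.1.2 \in E & F.2 \in E].
Proof.
by case/allpairsP=> -[uv w] /= [/allpairsP[[u v] /= [Eu Ev ->]] Ew ->].
Qed.

Lemma mem_stabilizer E F g : F \in triples E -> unit3 F -> preserves E g ->
  g \in stabilizer E F.
Proof.
move=> EF uF Eg; rewrite mem_filter Eg /=; apply/mapP.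
exists (mul3 F g); last by rewrite mul3A mulV3 // mul13.
move: Eg; rewrite /preserves; case: ifP => // _ /allP Eg.
have [/Eg E1 /Eg E2 /Eg E3] := triplesP EF.
by case: F EF uF E1 E2 E3 => [[r1 r2] r3] /= *; apply: mem_triples.
Qed.

Lemma conjugate_into_one_ofP targets l s :
  conjugate_into_one_of targets l s ->
  exists2 P, unit3 P &
    exists2 t, t \in targets & {in s, forall g, conj3 P g \in t}.
Proof.
case/searchP=> A _ /searchP[B _] /=; case: ifP => // uP.
case/searchP=> t Tt /allP sP.
by exists (mul3 A B) => //; exists t.
Qed.

Lemma preserving_group_conjugate targets l E G :
  stabilizer_in_one_of targets l E -> ~~ degenerate E ->
  SL_subgroup G -> (forall A, G A -> preserves E (of_mx A)) ->
  exists2 t, t \in targets & exists2 H, Z_equivalent G H & H `<=` set_of t.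
Proof.
rewrite /stabilizer_in_one_of => + /negPf ndE sG GE; rewrite ndE.
case/searchP=> F EF; case: ifP => // uF.
case/conjugate_into_one_ofP=> P uP [t Tt stabP].
exists t => //; exists [set conjmx (mx_of P) A | A in G].
  by exists (mx_of P); rewrite ?unitmx_mx_of.
move=> _ [A GA <-]; rewrite -(of_mxK A) -mx_of_conj // set_of_mx.
by apply/stabP/mem_stabilizer/GE.
Qed.

Lemma preserving_group_in_maximal (p : pred row3) G :
  let E := [seq f <- forms | p f] in
  ~~ degenerate E ->
  SL_subgroup G -> (forall A, G A -> preserves E (of_mx A)) ->
  exists2 k, k \in maximal &
    exists2 H, Z_equivalent G H & H `<=` set_of (grp k).
Proof.
move=> E ndE sG GE.
have stabE := allP stabilizers_in_maximalT E (filter_sublists p forms).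
have [t /mapP[k max_k ->] GH] := preserving_group_conjugate stabE ndE sG GE.
by exists k.
Qed.

(** * Invariant forms and obtuse superbases *)

Definition app3 (A : mat) (v : row3) : row3 :=
  let: (r1, r2, r3) := A in (dot r1 v, dot r2 v, dot r3 v).

Definition qform (Q : mat) (v : row3) : int := dot v (app3 Q v).

Definition posdef (Q : mat) : Prop := forall v, v != (0, 0, 0) -> 0 < qform Q v.

Definition congr3 (P Q : mat) : mat := mul3 (mul3 (tr3 P) Q) P.

Lemma qform_congr P Q v : qform (congr3 P Q) v = qform Q (app3 P v).
Proof.
case: P => [[[[a b] c] [[d e] f]] [[g h] i]].
case: Q => [[[[a' b'] c'] [[d' e'] f']] [[g' h'] i']].
by case: v => [[x y] z]; rewrite /qform /=; ring.
Qed.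

Lemma app3_mul A B v : app3 (mul3 A B) v = app3 A (app3 B v).
Proof.
case: A => [[[[a b] c] [[d e] f]] [[g h] i]].
case: B => [[[[a' b'] c'] [[d' e'] f']] [[g' h'] i']].
by case: v => [[x y] z]; congr (_, _, _) => /=; ring.
Qed.

Lemma app3_id v : app3 one3 v = v.
Proof. by case: v => [[x y] z]; congr (_, _, _) => /=; ring. Qed.

Lemma app3_0 A : app3 A (0, 0, 0) = (0, 0, 0).
Proof.
case: A => [[[[a b] c] [[d e] f]] [[g h] i]].
by congr (_, _, _) => /=; rewrite !mulr0.
Qed.

Lemma app3_eq0 P v : unit3 P -> (app3 P v == (0, 0, 0)) = (v == (0, 0, 0)).
Proof.
move=> uP; apply/eqP/eqP=> [Pv0|->]; last exact: app3_0.
by rewrite -[v]app3_id -(mulV3 uP) app3_mul Pv0 app3_0.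
Qed.

Lemma posdef_congr P Q : unit3 P -> posdef Q -> posdef (congr3 P Q).
Proof. by move=> uP posQ v nzv; rewrite qform_congr posQ // app3_eq0. Qed.

Lemma congr3_mul P R Q : congr3 (mul3 P R) Q = congr3 R (congr3 P Q).
Proof.
apply: mx_of_inj; rewrite !(mx_of_mul, mx_of_tr) trmx_mul.
by rewrite !mulmxA.
Qed.

Lemma qformD (M N : 'M[int]_3) v :
  qform (of_mx (M + N)) v = qform (of_mx M) v + qform (of_mx N) v.
Proof. by case: v => [[x y] z]; rewrite /qform /= !mxE; ring. Qed.

Lemma qform0 v : qform (of_mx 0) v = 0.
Proof. by case: v => [[x y] z]; rewrite /qform /= !mxE; ring. Qed.

Lemma qform_gram A v : qform (of_mx ((mx_of A)^T *m mx_of A)) v =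
  dot (app3 A v) (app3 A v).
Proof.
rewrite -mx_of_tr -mx_of_mul mx_ofK.
case: A => [[[[a b] c] [[d e] f]] [[g h] i]].
by case: v => [[x y] z]; rewrite /qform /=; ring.
Qed.

Lemma dot_ge0 v : 0 <= dot v v.
Proof. by case: v => [[x y] z]; rewrite /= -!expr2 !addr_ge0 ?sqr_ge0. Qed.

Lemma dot_gt0 v : v != (0, 0, 0) -> 0 < dot v v.
Proof.
move=> nzv; rewrite lt_def dot_ge0 andbT; apply: contraNN nzv.
case: v => [[x y] z] /=; rewrite -!expr2.
rewrite !paddr_eq0 ?addr_ge0 ?sqr_ge0 // !sqrf_eq0.
by case/andP=> /andP[/eqP-> /eqP->] /eqP->.
Qed.

(** The sum of [A^T A] over the elements [A] of [G] is invariant, since right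
    multiplication by an element of [G] permutes [G]; the term of the identity
    makes it positive definite. *)
Lemma invariant_form (G : set 'M[int]_3) : SL_subgroup G -> finite_set G ->
  exists Q, [/\ tr3 Q = Q, posdef Q & forall A, G A -> congr3 (of_mx A) Q = Q].
Proof.
move=> [GSL G1 GM GV] /finite_seqP[s defG].
pose l := undup s; have lP A : (A \in l) = `[< G A >].
  by rewrite mem_undup; apply/idP/asboolP; rewrite defG.
pose Q := \sum_(A <- l) A^T *m A.
exists (of_mx Q); split.
- apply: mx_of_inj; rewrite mx_of_tr of_mxK /Q raddf_sum.
  by apply: eq_bigr => A _ /=; rewrite trmx_mul trmxK.
- move=> v nzv; rewrite /Q (big_morph (fun M => qform (of_mx M) v)
                                      (fun M N => qformD M N v) (qform0 v)).
  rewrite (bigD1_seq 1%:M) ?undup_uniq ?lP //=; last exact/asboolP.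
  rewrite ltr_wpDr //.
    by apply: sumr_ge0 => A _; rewrite -(of_mxK A) qform_gram dot_ge0.
  by rewrite -mx_of_id qform_gram app3_id dot_gt0.
move=> A GA; apply: mx_of_inj; rewrite !mx_of_mul mx_of_tr !of_mxK.
rewrite mulmx_sumr mulmx_suml.
have uA : A \in unitmx by apply/SL_unitmx/GSL.
have permA : perm_eq [seq B *m A | B <- l] l.
  apply: uniq_perm; rewrite ?undup_uniq ?map_inj_uniq ?undup_uniq //.
    exact: can_inj (mulmxK uA).
  move=> B; rewrite lP; apply/mapP/asboolP => [[C + ->]|GB].
    by rewrite lP => /asboolP GC; apply: GM.
  exists (B *m invmx A); last by rewrite mulmxKV.
  by rewrite lP; apply/asboolP/GM/GV.
rewrite -[RHS](perm_big _ permA) big_map; apply: eq_bigr => B _.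
by rewrite trmx_mul !mulmxA.
Qed.

(** Selling parameters: the coefficients of the squares of the linear forms of
    [forms], in the same order. Equivalently, they are the opposites of the
    inner products of the pairs [(e1, e0)], [(e2, e0)], [(e3, e0)], [(e1, e2)],
    [(e1, e3)], [(e2, e3)], where [e1, e2, e3] is the basis and
    [e0 = - e1 - e2 - e3]. *)
Notation params := (int * int * int * int * int * int)%type.

Definition selling_form (p : params) : mat :=
  let: (a, b, c, d, e, f) := p in
  ((a + d + e, - d, - e), (- d, b + d + f, - f), (- e, - f, c + e + f)).

Definition selling_sum (p : params) : int :=
  let: (a, b, c, d, e, f) := p in a + b + c + d + e + f.

Definition obtuse (p : params) : bool :=
  let: (a, b, c, d, e, f) := p in
  [&& 0 <= a, 0 <= b, 0 <= c, 0 <= d, 0 <= e & 0 <= f].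

Lemma symmetric_selling_form Q : tr3 Q = Q -> exists p, Q = selling_form p.
Proof.
case: Q => [[[[a b] c] [[d e] f]] [[g h] i]] [-> -> _ -> _ _].
exists (a + b + c, b + e + f, c + f + i, - b, - c, - f) => /=.
by congr (_, _, _); congr (_, _, _); ring.
Qed.

(** If the parameter of the pair [(e_i, e_j)] is negative, the four vectors are
    replaced by [- e_i], [e_j] and the sums [e_k + e_i], [e_l + e_i]. These
    again have sum 0, and the sum of the parameters, which is half the sum of
    the squared lengths, changes by the negative parameter. *)
Lemma selling_flip p : ~~ obtuse p ->
  exists P p', [/\ unit3 P, congr3 P (selling_form p) = selling_form p'
                 & selling_sum p' < selling_sum p].
Proof.
move: p => [[[[[a b] c] d] e] f] /=.
have flip P p' : unit3 P ->
    congr3 P (selling_form (a, b, c, d, e, f)) = selling_form p' ->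
    selling_sum p' < a + b + c + d + e + f ->
  exists P p', [/\ unit3 P,
      congr3 P (selling_form (a, b, c, d, e, f)) = selling_form p'
    & selling_sum p' < a + b + c + d + e + f] by exists P, p'.
rewrite !negb_and -!ltNge => /or4P[neg|neg|neg|/or3P[]neg].
- apply: (flip ((-1, 1, 1), (0, 1, 0), (0, 0, 1))
               (- a, b + a, c + a, a + e, a + d, f - a)) => //.
    by congr (_, _, _); congr (_, _, _) => /=; ring.
  by rewrite /=; lia.
- apply: (flip ((1, 0, 0), (1, -1, 1), (0, 0, 1))
               (a + b, - b, c + b, b + f, e - b, b + d)) => //.
    by congr (_, _, _); congr (_, _, _) => /=; ring.
  by rewrite /=; lia.
- apply: (flip ((1, 0, 0), (0, 1, 0), (1, 1, -1))
               (a + c, b + c, - c, d - c, c + f, c + e)) => //.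
    by congr (_, _, _); congr (_, _, _) => /=; ring.
  by rewrite /=; lia.
- apply: (flip ((-1, 0, 1), (0, 1, 0), (0, 0, 1))
               (d + e, b + d, c - d, - d, d + a, f + d)) => //.
    by congr (_, _, _); congr (_, _, _) => /=; ring.
  by rewrite /=; lia.
- apply: (flip ((-1, 1, 0), (0, 1, 0), (0, 0, 1))
               (e + d, b - e, c + e, e + a, - e, f + e)) => //.
    by congr (_, _, _); congr (_, _, _) => /=; ring.
  by rewrite /=; lia.
- apply: (flip ((1, 0, 0), (1, -1, 0), (0, 0, 1))
               (a - f, f + d, c + f, f + b, e + f, - f)) => //.
    by congr (_, _, _); congr (_, _, _) => /=; ring.
  by rewrite /=; lia.
Qed.

Lemma selling_sum_gt0 p : posdef (selling_form p) -> 0 < selling_sum p.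
Proof.
move=> posp; have := posp (1, 0, 0) isT; have := posp (0, 1, 0) isT.
have := posp (0, 0, 1) isT; have := posp (1, 1, 1) isT.
by move: p {posp} => [[[[[a b] c] d] e] f]; rewrite /qform /=; lia.
Qed.

(** Flips terminate, because the sum of the parameters is a positive integer as
    long as the form is positive definite. *)
Lemma obtuse_superbase Q : tr3 Q = Q -> posdef Q ->
  exists P p, [/\ unit3 P, congr3 P Q = selling_form p & obtuse p].
Proof.
move=> /symmetric_selling_form[p ->].
elim: {p}_.+1 {-2}p (ltnSn `|selling_sum p|%N) => // n IHn p le_n posp.
have [obt|/selling_flip[P [p' [uP defp' lt_p']]]] := boolP (obtuse p).
  exists one3, p; split=> //; apply: mx_of_inj.
  by rewrite !mx_of_mul mx_of_tr mx_of_id trmx1 mul1mx mulmx1.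
have posp' : posdef (selling_form p') by rewrite -defp'; apply: posdef_congr.
have [|R [p'' [uR defp'' obt]]] := IHn p' _ posp'.
  by have := selling_sum_gt0 posp'; lia.
exists (mul3 P R), p''; split=> //; last by rewrite congr3_mul defp'.
by rewrite -unitmx_mx_of mx_of_mul unitmx_mul !unitmx_mx_of uP.
Qed.

(** * Symmetries of an obtuse form permute its linear forms *)

Definition weight (p : params) (f : row3) : int :=
  let: (a, b, c, d, e, f') := p in nth 0 [:: a; b; c; d; e; f'] (index f forms).

(** The parameter at [f] of the square of the linear form [r]. *)
Definition selling_coef (f r : row3) : int :=
  let: (x, y, z) := r in
  nth 0 [:: x * (x + y + z); y * (x + y + z); z * (x + y + z);
            - (x * y); - (x * z); - (y * z)] (index f forms).

Lemma weight_ge0 p f : obtuse p -> 0 <= weight p f.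
Proof.
case: p => [[[[[a b] c] d] e] f'] /and5P[a0 b0 c0 d0 /andP[e0 f0]].
rewrite /weight; by case: (index f forms) => [|[|[|[|[|[|[|?]]]]]]].
Qed.

Lemma qform_selling p v :
  qform (selling_form p) v = \sum_(f <- forms) weight p f * dot f v ^+ 2.
Proof.
case: p => [[[[[a b] c] d] e] f']; case: v => [[x y] z].
by rewrite /qform /forms !big_cons big_nil /weight /=; ring.
Qed.

Lemma dot_row_mul3 f g v : dot (row_mul3 f g) v = dot f (app3 g v).
Proof.
case: g => [[[[a b] c] [[d e] f']] [[g h] i]].
by case: f v => [[? ?] ?] [[? ?] ?] /=; ring.
Qed.

(** Both sides are the parameter at [h] of the form [p], the right-hand one
    after the substitution [g] has been carried out in each square. *)
Lemma weight_congr p g h : congr3 g (selling_form p) = selling_form p ->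
  weight p h = \sum_(f <- forms) weight p f * selling_coef h (row_mul3 f g).
Proof.
pose param (Q : mat) :=
  let: ((q11, q12, q13), (_, q22, q23), (_, _, q33)) := Q in
  nth 0 [:: q11 + q12 + q13; q12 + q22 + q23; q13 + q23 + q33;
            - q12; - q13; - q23] (index h forms).
move=> pres_p; transitivity (param (selling_form p)).
  case: p {pres_p} => [[[[[a b] c] d] e] f']; rewrite /weight /param {param}.
  by case: (index h forms) => [|[|[|[|[|[|[|?]]]]]]] //=; ring.
rewrite -{}pres_p; case: p => [[[[[a b] c] d] e] f'].
case: g => [[[[g11 g12] g13] [[g21 g22] g23]] [[g31 g32] g33]].
rewrite /forms !big_cons big_nil /param /selling_coef {param}.
by case: (index h forms) => [|[|[|[|[|[|[|?]]]]]]]; rewrite /weight /=; ring.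
Qed.

Definition bounded (r : row3) : bool := all (fun u => `|dot r u| <= 1) cube.

(** Two entries of the same sign would add up to 2 or -2 at a vector of the
    cube, so a bounded form has at most one entry 1 and one entry -1. *)
Lemma bounded_form r : bounded r ->
  (forall h, h \in forms -> 0 <= selling_coef h r) /\
  (r != (0, 0, 0) ->
   exists2 h, h \in forms & selling_coef h r = 1 /\ r \in signed [:: h]).
Proof.
pose small : seq int := [:: -1; 0; 1].
pose rows : seq row3 :=
  [seq (xy, z) | xy <- [seq (x, y) | x <- small, y <- small], z <- small].
move=> br; have r_rows : r \in rows.
  have := allP br (1, 0, 0) isT; have := allP br (0, 1, 0) isT.
  have := allP br (0, 0, 1) isT.
  case: r {br} => [[x y] z] /=.
  rewrite !(mulr0, mulr1, addr0, add0r) => bz By bx.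
  have sm (t : int) : `|t| <= 1 -> t \in small by rewrite !inE; lia.
  apply/allpairsP; exists ((x, y), z); split; rewrite ?sm //.
  by apply: allpairs_f; rewrite sm.
have check : all (fun r => bounded r ==>
    all (fun h => 0 <= selling_coef h r) forms &&
    ((r != (0, 0, 0)) ==>
     has (fun h => (selling_coef h r == 1) && (r \in signed [:: h])) forms))
    rows.
  by vm_compute.
have /implyP/(_ br)/andP[/allP ge0 /implyP some] := allP check r r_rows.
by split=> // /some/hasP[h hF /andP[/eqP ch rh]]; exists h.
Qed.

Definition shift2 (u w : row3) : row3 :=
  (u.1.1 + 2 * w.1.1, u.1.2 + 2 * w.1.2, u.2 + 2 * w.2).

Lemma parity_cube (x : row3) : exists2 u, u \in cube & exists w, x = shift2 u w.
Proof.
case: x => [[x y] z].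
exists ((x %% 2)%Z, (y %% 2)%Z, (z %% 2)%Z); last first.
  by exists ((x %/ 2)%Z, (y %/ 2)%Z, (z %/ 2)%Z); congr (_, _, _) => /=; lia.
have bit (t : int) : (t %% 2)%Z = 0 \/ (t %% 2)%Z = 1 by lia.
by case: (bit x) (bit y) (bit z) => -> [] -> [] ->.
Qed.

(** The two values have the same parity, and the one at [u] is -1, 0 or 1. *)
Lemma sqr_dot_shift2 f u w : f \in forms -> u \in cube ->
  dot f u ^+ 2 <= dot f (shift2 u w) ^+ 2 /\
  (dot f u ^+ 2 = dot f (shift2 u w) ^+ 2 -> `|dot f (shift2 u w)| <= 1).
Proof.
move=> fF uC; have bu : `|dot f u| <= 1.
  have small : all (fun f => all (fun u => `|dot f u| <= 1) cube) forms.
    by vm_compute.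
  exact: (allP (allP small f fF) u uC).
have -> : dot f (shift2 u w) = dot f u + 2 * dot f w.
  by case: f u w {fF uC bu} => [[? ?] ?] [[? ?] ?] [[? ?] ?] /=; ring.
by split; nia.
Qed.

Lemma app3_shift2 A u w : app3 A (shift2 u w) = shift2 (app3 A u) (app3 A w).
Proof.
case: A => [[[[a b] c] [[d e] f]] [[g h] i]].
case: u w => [[? ?] ?] [[? ?] ?].
by rewrite /shift2 /=; congr (_, _, _); ring.
Qed.

(** Each of the squares in the form is already minimal, on the class of [u] modulo
    2, at the vector [u] of the cube. *)
Lemma qform_shift2 p u w : obtuse p -> u \in cube ->
  qform (selling_form p) u <= qform (selling_form p) (shift2 u w).
Proof.
move=> obt uC; rewrite !qform_selling big_seq [leRHS]big_seq.
apply: ler_sum => f fF; rewrite ler_wpM2l ?weight_ge0 //.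
by have [] := sqr_dot_shift2 w fF uC.
Qed.

(** A vector as short as the vector of the cube in its class makes all the
    inequalities between the terms of the form equalities. *)
Lemma minimal_bounded p u w f : obtuse p -> u \in cube ->
  qform (selling_form p) (shift2 u w) <= qform (selling_form p) u ->
  f \in forms -> 0 < weight p f -> `|dot f (shift2 u w)| <= 1.
Proof.
move=> obt uC le_q fF pos_f.
have term_ge0 h : h \in forms ->
    0 <= weight p h * (dot h (shift2 u w) ^+ 2 - dot h u ^+ 2).
  move=> hF; rewrite mulr_ge0 ?weight_ge0 // subr_ge0.
  by have [] := sqr_dot_shift2 w hF uC.
have sum0 : \sum_(h <- forms | h \in forms)
    weight p h * (dot h (shift2 u w) ^+ 2 - dot h u ^+ 2) == 0.
  rewrite eq_le sumr_ge0 // andbT -big_seq.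
  under eq_bigr do rewrite mulrBr.
  by rewrite sumrB -!qform_selling subr_le0.
move: sum0; rewrite psumr_eq0 // => /allP/(_ f fF); rewrite fF /=.
rewrite mulf_eq0 gt_eqF //= subr_eq0 => /eqP eq_f.
by have [_] := sqr_dot_shift2 w fF uC; apply.
Qed.

(** Let [u] be in the cube and [v] the vector of the cube congruent to [g u].
    Since [g^-1 v] is congruent to [u], the form at [v] is at least the form at
    [u], that is, at [g u], which is therefore minimal in its class. Hence the
    image of a positive form is bounded, so it is one of the six up to sign. *)
Lemma preserves_positive_forms p g : obtuse p -> det3 g = 1 ->
  congr3 g (selling_form p) = selling_form p ->
  preserves [seq f <- forms | 0 < weight p f] g.
Proof.
move=> obt det_g pres_p; rewrite /preserves det_g eqxx.
have ug : unit3 g by rewrite /unit3 det_g.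
have q_app v : qform (selling_form p) (app3 g v) = qform (selling_form p) v.
  by rewrite -qform_congr pres_p.
have image_bounded f : f \in forms -> 0 < weight p f -> bounded (row_mul3 f g).
  move=> fF pos_f; apply/allP=> u uC; rewrite dot_row_mul3.
  have [v vC [w def_gu]] := parity_cube (app3 g u); rewrite def_gu.
  apply: (minimal_bounded obt vC _ fF pos_f); rewrite -def_gu q_app.
  have -> : qform (selling_form p) v =
            qform (selling_form p) (app3 (inv3 g) v).
    by rewrite -[RHS]q_app -app3_mul mul3V // app3_id.
  have -> : app3 (inv3 g) v = shift2 u (app3 (inv3 g) (opp3 w)).
    rewrite -[u]app3_id -(mulV3 ug) app3_mul def_gu -app3_shift2.
    case: v w {vC def_gu} => [[? ?] ?] [[? ?] ?].
    by congr (app3 _ (_, _, _)) => /=; ring.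
  exact: qform_shift2.
apply/allP=> f; rewrite mem_filter => /andP[pos_f fF].
have [_ /(_ _)[|h hF [coef_h fg_h]]] := bounded_form (image_bounded f fF pos_f).
  apply/eqP => fg0; have nzf : f != (0, 0, 0) by apply: contraTneq fF => ->.
  have := dot_gt0 nzf.
  rewrite -{2}[f]app3_id -(mul3V ug) app3_mul -dot_row_mul3 fg0.
  by case: (app3 _ f) => [[? ?] ?]; rewrite /= !mul0r.
(* The term of [f] alone contributes a positive amount to the weight of [h]. *)
have pos_h : 0 < weight p h.
  rewrite (weight_congr h pres_p) (bigD1_seq f) //= coef_h mulr1 ltr_wpDr //.
  rewrite big_seq_cond; apply: sumr_ge0 => f' /andP[f'F _].
  have [pos_f'|npos_f'] := boolP (0 < weight p f').
    rewrite mulr_ge0 ?weight_ge0 //.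
    by have [->] := bounded_form (image_bounded f' f'F pos_f').
  suff -> : weight p f' = 0 by rewrite mul0r.
  by apply/eqP; rewrite eq_le weight_ge0 // andbT leNgt.
have Eh : h \in [seq f <- forms | 0 < weight p f] by rewrite mem_filter pos_h.
move: fg_h; rewrite mem_cat !inE /signed mem_cat => /orP[]/eqP->.
  by rewrite Eh.
by rewrite map_f ?orbT.
Qed.

(** A common zero of the positive forms would be one of the quadratic form. *)
Lemma positive_forms_nondegenerate p : posdef (selling_form p) ->
  obtuse p -> ~~ degenerate [seq f <- forms | 0 < weight p f].
Proof.
move=> posp obt; apply/hasP => -[v _ /andP[nzv /allP Ev]].
have := posp v nzv; rewrite qform_selling big_seq big1 ?ltxx // => f fF.
have [pos_f|npos_f] := boolP (0 < weight p f).
  have /eqP -> : dot f v == 0 by apply: Ev; rewrite mem_filter pos_f.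
  by rewrite expr0n mulr0.
suff -> : weight p f = 0 by rewrite mul0r.
by apply/eqP; rewrite eq_le weight_ge0 // andbT leNgt.
Qed.

Lemma finite_in_maximal G : SL_subgroup G -> finite_set G ->
  exists2 k, k \in maximal &
    exists2 H, Z_equivalent G H & H `<=` set_of (grp k).
Proof.
move=> sG finG; have [Q [symQ posQ GQ]] := invariant_form sG finG.
have [P [p [uP defp obt]]] := obtuse_superbase symQ posQ.
have posp : posdef (selling_form p) by rewrite -defp; apply: posdef_congr.
pose G' := [set conjmx (mx_of P) A | A in G].
have eqG : Z_equivalent G G' by exists (mx_of P); rewrite ?unitmx_mx_of.
have sG' := Z_equivalent_subgroup eqG sG.
have [|A [B GB <-]|k max_k [H eqH sHk]] :=
    @preserving_group_in_maximal (fun f => 0 < weight p f) G' _ sG'.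
- exact: positive_forms_nondegenerate.
- apply: preserves_positive_forms => //.
    rewrite -det_mx_of of_mxK det_conjmx ?unitmx_mx_of //.
    by have [GSL _ _ _] := sG; apply: GSL.
  rewrite -{1}(of_mxK B) -mx_of_conj // mx_ofK -defp /conj3 -!congr3_mul.
  by rewrite !mul3A mul3V // mul13 congr3_mul GQ.
by exists k => //; exists H => //; apply: Z_equivalent_trans eqH.
Qed.

(** * Invariants of integral conjugacy *)

Lemma unit3_inv P : unit3 P -> unit3 (inv3 P).
Proof.
by move=> uP; rewrite -unitmx_mx_of mx_of_inv // unitmx_inv unitmx_mx_of.
Qed.

Lemma unit3_tr P : unit3 (tr3 P) = unit3 P.
Proof. by rewrite -!unitmx_mx_of mx_of_tr unitmx_tr. Qed.

Lemma inv3_tr P : unit3 P -> inv3 (tr3 P) = tr3 (inv3 P).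
Proof.
move=> uP; apply: mx_of_inj.
by rewrite mx_of_inv ?unit3_tr // !mx_of_tr mx_of_inv // trmx_inv.
Qed.

Lemma inv3K P : unit3 P -> inv3 (inv3 P) = P.
Proof.
by move=> uP; apply: mx_of_inj; rewrite !mx_of_inv ?unit3_inv // invmxK.
Qed.

Lemma conj3VK P A : unit3 P -> conj3 (inv3 P) (conj3 P A) = A.
Proof.
move=> uP; rewrite /conj3 inv3K // !mul3A mul3V // mul13 -mul3A mul3V //.
by rewrite mul31.
Qed.

Lemma tr3_mul A B : tr3 (mul3 A B) = mul3 (tr3 B) (tr3 A).
Proof. by apply: mx_of_inj; rewrite !(mx_of_tr, mx_of_mul) trmx_mul. Qed.

Lemma tr3_conj P A : unit3 P -> tr3 (conj3 P A) = conj3 (inv3 (tr3 P)) (tr3 A).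
Proof.
move=> uP; rewrite /conj3 !tr3_mul inv3K ?unit3_tr // inv3_tr //.
by rewrite mul3A.
Qed.

Lemma trace3_conj P A : unit3 P -> trace3 (conj3 P A) = trace3 A.
Proof.
have mxtr B : \tr (mx_of B) = trace3 B.
  case: B => [[[[a b] c] [[d e] f]] [[g h] i]].
  by rewrite /mxtrace !big_ord_recl big_ord0 !mxE /=; ring.
move=> uP; rewrite -!mxtr mx_of_mul mxtrace_mulC -mx_of_mul mul3A mul3V //.
by rewrite mul13.
Qed.

Lemma Z_equivalent_lists l l' : is_group l -> is_group l' ->
  Z_equivalent (set_of l) (set_of l') ->
  exists2 P, unit3 P & perm_eq l' [seq conj3 P A | A <- l].
Proof.
move=> /andP[ul _] /andP[ul' _] [P uP defl'].
have uP' : unit3 (of_mx P) by rewrite -unitmx_mx_of of_mxK.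
exists (of_mx P) => //; apply: uniq_perm => // [|A].
  by rewrite map_inj_uniq //; apply: can_inj (fun A => conj3VK A uP').
apply/idP/mapP => [|[B lB ->]]; rewrite -set_of_mx defl'.
  case=> [B lB defA]; exists (of_mx B) => //; apply: mx_of_inj.
  by rewrite mx_of_conj // !of_mxK.
rewrite mx_of_conj // of_mxK; exists (mx_of B) => //.
by rewrite set_of_mx.
Qed.

Definition mod3 (m : nat) (v : row3) : row3 :=
  let: (x, y, z) := v in ((x %% m)%Z, (y %% m)%Z, (z %% m)%Z).

Definition residues (m : nat) : seq row3 :=
  let s := [seq Posz i | i <- iota 0 m] in
  [seq (xy, z) | xy <- [seq (x, y) | x <- s, y <- s], z <- s].

Definition fixes (m : nat) (A : mat) (v : row3) : bool :=
  mod3 m (app3 A v) == mod3 m v.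

Definition fixed_count (m : nat) (l : seq mat) : nat :=
  count (fun v => all (fun A => fixes m A v) l) (residues m).

Lemma mod3_app m A v : mod3 m (app3 A (mod3 m v)) = mod3 m (app3 A v).
Proof.
have mod_dot r : (dot r (mod3 m v) = dot r v %[mod m])%Z.
  case: r v => [[a b] c] [[x y] z] /=.
  rewrite [in RHS](divz_eq x m) [in RHS](divz_eq y m) [in RHS](divz_eq z m).
  rewrite -[LHS](modzMDl (a * (x %/ m)%Z + b * (y %/ m)%Z + c * (z %/ m)%Z)).
  by congr (_ %% _)%Z; ring.
by case: A => [[r1 r2] r3] /=; rewrite !mod_dot.
Qed.

Lemma mod3_residue m v : (0 < m)%N -> mod3 m v \in residues m.
Proof.
move=> m0; have modm (t : int) : (t %% m)%Z \in [seq Posz i | i <- iota 0 m].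
  have m_gt0 : 0 < Posz m by [].
  have := modz_ge0 t (lt0r_neq0 m_gt0); have := ltz_pmod t m_gt0.
  by case: (t %% m)%Z => // r lt_r _; apply: map_f; rewrite mem_iota.
case: v => [[x y] z]; apply/allpairsP; eexists (_, _, _); split=> //=.
by apply: allpairs_f.
Qed.

Lemma residues_mod3 m v : v \in residues m -> mod3 m v = v.
Proof.
have modm (t : int) : t \in [seq Posz i | i <- iota 0 m] -> (t %% m)%Z = t.
  by case/mapP=> i; rewrite mem_iota => lt_i ->; rewrite modz_small.
case/allpairsP=> -[[x y] z] /= [/allpairsP[[x' y'] /= [? ? [-> ->]]] ? ->] /=.
by rewrite !modm.
Qed.

Lemma residues_uniq m : uniq (residues m).
Proof.
have us : uniq [seq Posz i | i <- iota 0 m].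
  by rewrite map_inj_uniq ?iota_uniq // => ? ? [].
apply: allpairs_uniq => [||[? ?] [? ?]] //.
by apply: allpairs_uniq => // -[? ?] [? ?].
Qed.

(** The inverse of [P] maps the fixed vectors of the group to those of its
    conjugate, injectively modulo [m]. *)
Lemma fixed_count_le m P l : (0 < m)%N -> unit3 P ->
  (fixed_count m l <= fixed_count m [seq conj3 P A | A <- l])%N.
Proof.
move=> m0 uP; rewrite /fixed_count -!size_filter.
set s := filter _ _; set s' := filter _ _.
pose phi v := mod3 m (app3 (inv3 P) v).
have phiK v : v \in s -> mod3 m (app3 P (phi v)) = v.
  rewrite mem_filter => /andP[_ /residues_mod3 {2}<-].
  by rewrite mod3_app -app3_mul mul3V // app3_id.
rewrite -(size_map phi); apply: uniq_leq_size => [|_ /mapP[v sv ->]].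
  rewrite map_inj_in_uniq ?filter_uniq ?residues_uniq // => v w sv sw eq_phi.
  by rewrite -(phiK v sv) eq_phi phiK.
rewrite mem_filter mod3_residue // andbT all_map; apply/allP=> A lA.
move: sv; rewrite mem_filter.
case/andP=> /allP/(_ A lA)/eqP fixA /residues_mod3 v_res.
rewrite /= /fixes /phi mod3_app -app3_mul.
rewrite (_ : mul3 _ _ = mul3 (inv3 P) A); last first.
  by rewrite -mul3A mul3V // mul31.
rewrite app3_mul -mod3_app fixA v_res; apply/eqP/esym.
by rewrite residues_mod3 ?mod3_residue.
Qed.

Lemma fixed_count_conj m P l : (0 < m)%N -> unit3 P ->
  fixed_count m [seq conj3 P A | A <- l] = fixed_count m l.
Proof.
move=> m0 uP; apply/eqP; rewrite eqn_leq fixed_count_le // andbT.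
apply: leq_trans (fixed_count_le _ m0 (unit3_inv uP)) _.
by rewrite -map_comp (eq_map (fun A => conj3VK A uP)) map_id.
Qed.

(** Rotations of order 2 have trace -1 and those of order 3 trace 0. Transposed
    matrices describe the action on the dual lattice. *)
Definition invariants (l : seq mat) : seq nat :=
  [:: count (fun A => trace3 A == -1) l; count (fun A => trace3 A == 0) l;
      fixed_count 2 l; fixed_count 3 l;
      fixed_count 2 [seq tr3 A | A <- l]; fixed_count 3 [seq tr3 A | A <- l]].

Lemma invariants_perm l l' : perm_eq l l' -> invariants l = invariants l'.
Proof.
move=> eql; have eqf m (f : mat -> mat) :
    fixed_count m (map f l) = fixed_count m (map f l').
  by apply: eq_count => v; rewrite !all_map; apply/perm_all.
have := eqf ^~ id; rewrite !map_id => eqid.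
by rewrite /invariants !eqf !eqid !(seq.permP eql).
Qed.

Lemma invariants_conj P l : unit3 P ->
  invariants [seq conj3 P A | A <- l] = invariants l.
Proof.
move=> uP; have uP' : unit3 (inv3 (tr3 P)) by rewrite unit3_inv ?unit3_tr.
rewrite /invariants -map_comp (eq_map (fun A => tr3_conj A uP)).
rewrite (map_comp (conj3 (inv3 (tr3 P)))) !fixed_count_conj // !count_map.
by congr [:: _, _ & _]; apply: eq_count => A /=; rewrite trace3_conj.
Qed.

Definition class_invariants : seq (seq nat) :=
  [seq invariants (grp k) | k <- all_classes].

Lemma class_invariants_uniq : uniq class_invariants.
Proof. by vm_compute. Qed.

Lemma Z_equivalent_grp k k' :
  Z_equivalent (set_of (grp k)) (set_of (grp k')) -> k = k'.
Proof.
case/(Z_equivalent_lists (is_group_grp k) (is_group_grp k')) => P uP.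
move/invariants_perm; rewrite invariants_conj // => eq_inv.
have classesP c : c \in all_classes by case: c.
by apply: (uniq_map_inj class_invariants_uniq) => //; apply: esym.
Qed.

(** * Isomorphism types *)

HB.instance Definition _ :=
  @CanIsCountable (row3 * row3 * row3)%type mat id id (fun=> erefl).

(** The proof is a parameter of the type so that the group structure can depend on
    it. *)
Definition list_group (l : seq mat) of is_group l := seq_sub l.

Section ListGroup.

Variables (l : seq mat) (gl : is_group l).
Notation T := (list_group gl).

HB.instance Definition _ := Finite.on T.

Lemma is_group_parts : [/\ one3 \in l, {in l &, forall A B, mul3 A B \in l},
  {in l, forall A, inv3 A \in l} & {in l, forall A, unit3 A}].
Proof.
case/and5P: gl => _ l1 /allP lSL /allP lM /allP lV; split=> // [A B lA lB|A lA].
  exact: (allP (lM A lA)).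
by rewrite /unit3 (lSL A lA).
Qed.

Let l1 : one3 \in l. Proof. by have [] := is_group_parts. Qed.
Let lM (x y : T) : mul3 (val x) (val y) \in l.
Proof. by have [_ lM _ _] := is_group_parts; apply: lM; apply: valP. Qed.
Let lV (x : T) : inv3 (val x) \in l.
Proof. by have [_ _ lV _] := is_group_parts; apply: lV; apply: valP. Qed.

Definition lg_one : T := SeqSub l1.
Definition lg_mul (x y : T) : T := SeqSub (lM x y).
Definition lg_inv (x : T) : T := SeqSub (lV x).

Lemma lg_mulA : associative lg_mul.
Proof. by move=> x y z; apply: val_inj; apply: mul3A. Qed.
Lemma lg_mul1 : left_id lg_one lg_mul.
Proof. by move=> x; apply: val_inj; apply: mul13. Qed.
Lemma lg_mulV : left_inverse lg_one lg_inv lg_mul.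
Proof.
move=> x; apply: val_inj; apply: mulV3.
by have [_ _ _ lU] := is_group_parts; apply/lU/valP.
Qed.

HB.instance Definition _ := Finite_isGroup.Build T lg_mulA lg_mul1 lg_mulV.

Lemma isomorphic_to_list (gT : finGroupType) (K : {group gT}) :
  (K \isog [set: T]%SET)%g -> isomorphic_to K (set_of l).
Proof.
case/isogP=> f injf imf; exists (fun x => mx_of (val (f x))); split.
- by move=> x y Kx Ky; rewrite morphM //= mx_of_mul.
- by move=> x y Kx Ky /mx_of_inj/val_inj; apply: (injmP injf).
apply/seteqP; split=> [_ [x _ <-]|A lA].
  by rewrite set_of_mx; apply: valP.
have : (SeqSub lA : T) \in (f @* K)%g by rewrite imf inE.
case/morphimP=> x Kx _ /(congr1 val) /= defA.
by exists x; rewrite //= -defA of_mxK.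
Qed.

(** Two distinct involutions generate a dihedral group. *)
Lemma dihedral_list (A B : mat) : A \in l -> B \in l ->
  mul3 A A = one3 -> mul3 B B = one3 -> A != one3 -> B != one3 -> A != B ->
  all (mem (closure [:: A; B])) l ->
  isomorphic_to 'D_(size l)%G (set_of l).
Proof.
move=> lA lB A2 B2 nzA nzB neAB /allP genl.
pose x : T := SeqSub lA; pose y : T := SeqSub lB.
have involution C (lC : C \in l) : mul3 C C = one3 -> C != one3 ->
    #[SeqSub lC : T]%g = 2%N.
  by move=> C2 nzC; apply: nt_prime_order => //; apply: val_inj.
pose D : {group T} := <<[set x; y]%SET>>%G.
(* The matrices of [D] form a group containing [A] and [B], hence their closure,
   which is everything. *)
pose image := [set mx_of (val z) | z in [set` D]].
have image_subgroup : SL_subgroup image.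
  split=> [_ [z _ <-]||_ _ [z Dz <-] [t Dt <-]|_ [z Dz <-]].
  - have [lSL _ _ _] := is_group_subgroup gl.
    by apply: lSL; rewrite set_of_mx; apply: valP.
  - by exists 1%g; [exact: (group1 D) | rewrite -mx_of_id].
  - by exists (z * t)%g; [exact: (groupM Dz Dt) | rewrite -mx_of_mul].
  exists z^-1%g; first by rewrite /= groupV.
  rewrite -mx_of_inv //; have [_ _ _ lU] := is_group_parts.
  exact/lU/valP.
have fullD : (D : {set T}) = [set: T]%SET.
  apply/setP=> z; rewrite !inE.
  have gens_image : {in [:: A; B], forall C, image (mx_of C)}.
    move=> C; rewrite !inE => /orP[]/eqP->; [exists x | exists y] => //=;
      by rewrite mem_gen // !inE eqxx ?orbT.
  have := closure_min image_subgroup gens_image.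
  move=> /(_ (mx_of (val z))); rewrite set_of_mx.
  case=> [|t Dt /mx_of_inj/val_inj <- //]; exact/genl/valP.
have neq_xy : x != y by apply: contraNneq neAB => /(congr1 val) /= ->.
have := involutions_gen_dihedral (involution A lA A2 nzA)
                                 (involution B lB B2 nzB) neq_xy.
rewrite -/(gval D) fullD.
rewrite cardsT card_seq_sub; last by case/and5P: gl.
by move=> isoD; apply: isomorphic_to_list; rewrite isog_sym.
Qed.

End ListGroup.

(** The first generator is an involution that inverts the second, so its
    product with the second is again an involution. *)
Definition dihedral_gens (k : Zclass) : mat * mat :=
  ((gens k).1, mul3 (gens k).1 (gens k).2).

Definition dihedral_check (k : Zclass) : bool :=
  let: (A, B) := dihedral_gens k in
  [&& A \in grp k, B \in grp k, mul3 A A == one3, mul3 B B == one3,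
      A != one3, B != one3, A != B & all (mem (closure [:: A; B])) (grp k)].

Lemma dihedral_class k : dihedral_check k ->
  isomorphic_to 'D_(size (grp k))%G (set_of (grp k)).
Proof.
case/and5P=> lA lB /eqP A2 /eqP B2 /and4P[nzA nzB neAB gen].
exact: (dihedral_list (is_group_grp k) lA lB).
Qed.

(** Permutations of a finite type do not evaluate, lists of their values do. *)
Definition code (s : {perm 'I_4}) : seq nat :=
  [seq val (s i) | i <- [:: inord 0; inord 1; inord 2; inord 3]].

Definition code_mul (c d : seq nat) : seq nat := [seq nth 0%N d i | i <- c].

Lemma nth_code s (i : 'I_4) : nth 0%N (code s) i = s i.
Proof.
by case: i => -[|[|[|[|?]]]] //= lt_i; congr (val (s _)); apply: val_inj;
  rewrite /= inordK.
Qed.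

Lemma codeM s t : code (s * t)%g = code_mul (code s) (code t).
Proof. by rewrite /code_mul {1 2}/code /= !nth_code !permM. Qed.

Lemma code_inj : injective code.
Proof.
move=> s t eq_st; apply/permP => i; apply: val_inj.
by have := nth_code s i; rewrite eq_st nth_code => /esym.
Qed.

Definition codes : seq (seq nat) := permutations (iota 0 4).

Lemma mem_codes s : code s \in codes.
Proof.
have u_code : uniq (code s).
  rewrite map_inj_uniq; last by move=> i j /val_inj/perm_inj.
  by rewrite /= !inE -!val_eqE /= !inordK.
have sub : {subset code s <= iota 0 4}.
  by move=> _ /mapP[i _ ->]; rewrite mem_iota ltn_ord.
rewrite mem_permutations; apply: uniq_perm => //.
by have [] := uniq_min_size u_code sub isT.
Qed.

Lemma codes_surj c : c \in codes -> exists s, code s = c.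
Proof.
have us : uniq [seq code s | s <- enum {perm 'I_4}].
  by rewrite map_inj_uniq ?enum_uniq //; apply: code_inj.
have sub : {subset [seq code s | s <- enum {perm 'I_4}] <= codes}.
  by move=> _ /mapP[s _ ->]; apply: mem_codes.
have [|_ eq_codes] := uniq_min_size us sub.
  by rewrite size_map -cardE -cardsT card_Sym card_ord; vm_compute.
by rewrite -eq_codes => /mapP[s _ ->]; exists s.
Qed.

(** The alternating group appears here as the set of squares, a description
    that evaluates on codes. *)
Definition even_codes : seq (seq nat) :=
  [seq c <- codes | has (fun d => c == code_mul d d) codes].

Lemma square_up_to_transposition : let evens := even_codes in
  all (fun c => (c \in evens) || (code_mul c [:: 1; 0; 2; 3] \in evens)) codes.
Proof. by vm_compute. Qed.

(** Squares are even. Conversely, a permutation of four points that is not a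
    square becomes one after multiplication by the transposition of the first
    two points, so it is odd. *)
Lemma even_codesP s : (code s \in even_codes) = ~~ odd_perm s.
Proof.
have even t : code t \in even_codes -> ~~ odd_perm t.
  rewrite mem_filter => /andP[/hasP[d /codes_surj[r <-] /eqP]] + _.
  by rewrite -codeM => /code_inj ->; rewrite odd_permM addbb.
apply/idP/idP=> [/even//|].
have /orP[//|] := allP square_up_to_transposition _ (mem_codes s).
have -> : [:: 1; 0; 2; 3]%N = code (tperm (inord 0) (inord 1)).
  have far i : (1 < i < 4)%N ->
      tperm (inord 0) (inord 1) (inord i) = inord i :> 'I_4.
    case/andP=> lt_1i lt_i4; rewrite tpermD // -val_eqE /= !inordK //.
      by rewrite ltn_eqF // ltnW.
    by rewrite ltn_eqF.
  by rewrite /code /= tpermL tpermR !far //= !inordK.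
rewrite -codeM => /even.
by rewrite odd_permM odd_tperm -val_eqE /= !inordK // addbT negbK => ->.
Qed.

(** Directions of the four axes of threefold rotations; the group permutes
    these axes, and a rotation in it is determined by the permutation. *)
Definition axes (k : Zclass) : seq row3 :=
  match k with
  | A4_1 | S4_1 => [:: (1, 1, 1); (1, -1, -1); (-1, 1, -1); (-1, -1, 1)]
  | A4_2 | S4_2 => [:: (1, 1, 1); (-3, 1, 1); (1, -3, 1); (1, 1, -3)]
  | _ => [:: (1, 1, 1); (1, 0, 0); (0, 1, 0); (0, 0, 1)]
  end.

(** The rotation takes the axis [c i] to the axis [i], and not the reverse,
    because products of permutations compose from left to right. *)
Definition moves_axes (k : Zclass) (c : seq nat) (g : mat) : bool :=
  let axis := nth (0, 0, 0) (axes k) in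
  all (fun i => app3 g (axis (nth 0%N c i)) \in signed [:: axis i]) (iota 0 4).

Definition rotation (k : Zclass) (c : seq nat) : mat :=
  nth one3 (grp k) (find (moves_axes k c) (grp k)).

Definition rotations_check (k : Zclass) (cs : seq (seq nat)) : bool :=
  let l := grp k in
  let table := [seq (c, rotation k c) | c <- cs] in
  [&& uniq [seq r.2 | r <- table], all (fun r => r.2 \in l) table,
      size l == size cs
    & all (fun r => all (fun t =>
        mul3 r.2 t.2 == rotation k (code_mul r.1 t.1)) table) table].

Lemma rotations_isomorphic k (cs : seq (seq nat)) (K : {group {perm 'I_4}}) :
  (forall s, (s \in K) = (code s \in cs)) -> {subset cs <= codes} ->
  rotations_check k cs -> isomorphic_to K (set_of (grp k)).
Proof.
move=> Kcs cs_codes /and4P[u_rot rot_l /eqP sz /allP morph].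
exists (fun s => mx_of (rotation k (code s))); split=> [s t Ks Kt|s t Ks Kt|].
- rewrite -mx_of_mul codeM; congr mx_of; apply/esym/eqP.
  rewrite Kcs in Ks; rewrite Kcs in Kt.
  exact: (allP (morph _ (map_f _ Ks)) _ (map_f _ Kt)).
- move=> /mx_of_inj eq_rot; apply: code_inj.
  rewrite Kcs in Ks; rewrite Kcs in Kt.
  by rewrite -map_comp in u_rot; apply: (uniq_map_inj u_rot).
pose table := [seq (c, rotation k c) | c <- cs].
have eq_l : [seq r.2 | r <- table] =i grp k.
  have sub : {subset [seq r.2 | r <- table] <= grp k}.
    by move=> _ /mapP[r tr ->]; apply: (allP rot_l).
  by have [|] := uniq_min_size u_rot sub; rewrite ?size_map ?sz.
apply/seteqP; split=> [_ [s Ks <-]|A].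
  rewrite set_of_mx -eq_l -map_comp; apply/mapP; exists (code s) => //.
  by rewrite -Kcs.
rewrite /set_of /= -eq_l -map_comp => /mapP[c cs_c defA].
have [s def_c] := codes_surj (cs_codes c cs_c).
by exists s; rewrite /= ?Kcs def_c // -[A]of_mxK defA.
Qed.

Lemma Zclass_type k : has_named_type k (set_of (grp k)).
Proof.
have dih m : dihedral_check k -> size (grp k) = m ->
    isomorphic_to 'D_m%G (set_of (grp k)).
  by move=> /dihedral_class + <-.
have alt : rotations_check k even_codes ->
    isomorphic_to 'Alt_('I_4)%G (set_of (grp k)).
  apply: rotations_isomorphic => [s|c]; last by rewrite mem_filter => /andP[].
  by rewrite Alt_even even_codesP.
have sym : rotations_check k codes ->
    isomorphic_to 'Sym_('I_4)%G (set_of (grp k)).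
  by apply: rotations_isomorphic => // s; rewrite inE mem_codes.
by case: k dih alt sym => dih alt sym; (apply: dih || apply: alt || apply: sym);
  vm_compute.
Qed.

(** * The classification *)

Theorem theorem1p6 :
  (forall k : Zclass,
     [/\ SL_subgroup (Zclass_group k),
         finite_set (Zclass_group k),
         ~ cyclic_SL_subgroup (Zclass_group k)
       & has_named_type k (Zclass_group k)])
  /\
  (forall G : set 'M[int]_3,
     SL_subgroup G -> finite_set G -> ~ cyclic_SL_subgroup G ->
     exists! k : Zclass, Z_equivalent G (Zclass_group k)).
Proof.
split=> [k|G sG finG ncycG].
  rewrite Zclass_groupE; split; last exact: Zclass_type.
  - exact/is_group_subgroup/is_group_grp.
  - exact: finite_set_of.
  - exact: grp_not_cyclic.
have [m max_m [H eqGH sHm]] := finite_in_maximal sG finG.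
have ncycH : ~ cyclic_SL_subgroup H by move/(Z_equivalent_cyclic sG eqGH).
have sH := Z_equivalent_subgroup eqGH sG.
have [k eqHk] := noncyclic_subgroup_of_maximal max_m sH sHm ncycH.
have eqGk := Z_equivalent_trans eqGH eqHk.
exists k; split=> [|k']; rewrite Zclass_groupE // => eqGk'.
exact/Z_equivalent_grp/(Z_equivalent_trans (Z_equivalent_sym eqGk)).
Qed.
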